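(* Let $X$ be a complex Banach space, $A\in B(X)$, and let $\Lambda$ be a spectral set for $A$. If $0\notin\Lambda$, then $A$ is Mary invertible along the spectral projection $P_\Lambda(A)$.
   Context: $\sigma(A)$ is the spectrum of $A$ and $R_\lambda(A)=(A-\lambda I)^{-1}$ for $\lambda\notin\sigma(A)$. A subset $\Lambda\subset\sigma(A)$ is a spectral set if both $\Lambda$ and $\sigma(A)\setminus\Lambda$ are closed. The spectral projection is $P_\Lambda(A)=-\frac{1}{2\pi i}\int_C R_\lambda(A)\,d\lambda$, where $C$ is a Cauchy contour separating $\Lambda$ from $\sigma(A)\setminus\Lambda$. $A$ is Mary invertible along $T\in B(X)$ if there exists $B\in B(X)$ with $BAB=B$ and $L,U,V,W\in B(X)$ such that $B=TU$, $T=BW$, $B=LT$, $T=VB$. *)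

(* Defs.v *)
From HB Require Import structures.
From mathcomp Require Import all_boot all_order all_algebra.
From mathcomp Require Import all_classical all_reals all_analysis.
From mathcomp Require Import complex.

Set Implicit Arguments.
Unset Strict Implicit.
Unset Printing Implicit Defensive.

Import Order.TTheory GRing.Theory Num.Theory.
Import numFieldNormedType.Exports.

Local Open Scope classical_set_scope.
Local Open Scope ring_scope.
Local Open Scope complex_scope.

(* The complex field C = R[i], seen as a numClosedFieldType (hence a normed
   field with its metric topology). *)
Definition CC (R : realType) : numClosedFieldType := R[i].

Section Defs.
Variable R : realType.
Local Notation C := (CC R).

Section Operators.
Variable X : normedModType C.

Definition bounded_op (T : X -> X) : Prop :=
  (forall (a : C) (x y : X), T (a *: x + y) = a *: T x + T y) /\ continuous T.

Definition spectrum (A : X -> X) : set C :=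
  [set l | ~ exists Bi : X -> X, bounded_op Bi /\
             (forall x, Bi (A x - l *: x) = x) /\
             (forall x, A (Bi x) - l *: Bi x = x)].

(* resolvent R_l(A) = (A - l I)^{-1}, evaluated pointwise: R_l(A) x is the
   (unique, when l \notin sigma(A)) y with (A - l I) y = x. *)
Definition resolvent (A : X -> X) (l : C) (x : X) : X :=
  xget 0 [set y | A y - l *: y = x].

Definition spectral_set (A : X -> X) (L : set C) : Prop :=
  L `<=` spectrum A /\ closed L /\ closed (spectrum A `\` L).

Definition mary_invertible_along (A T : X -> X) : Prop :=
  exists B : X -> X, bounded_op B /\ (forall x, B (A (B x)) = B x) /\
  exists L U V W : X -> X,
    [/\ bounded_op L, bounded_op U, bounded_op V & bounded_op W] /\
    [/\ forall x, B x = T (U x), forall x, T x = B (W x),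
        forall x, B x = L (T x) & forall x, T x = V (B x)].
End Operators.

Definition closed_lipschitz_curve (g : R -> C) : Prop :=
  g 0 = g 1 /\
  exists K : R, forall s t : R, 0 <= s <= 1 -> 0 <= t <= 1 ->
    `|g s - g t| <= K%:C * (`|s - t|)%:C.

(* Riemann-Stieltjes contour integral of f : C -> V along g over [0,1],
   as the limit of Riemann-Stieltjes sums over the uniform partitions. *)
Definition contour_integral (V : normedModType C) (g : R -> C) (f : C -> V) : V :=
  lim ((fun n : nat => \sum_(j < n)
          (g (j.+1%:R / n%:R) - g (j%:R / n%:R)) *: f (g (j%:R / n%:R))) @ \oo).

Definition cycle_integral (V : normedModType C) (G : seq (R -> C)) (f : C -> V) : V :=
  \sum_(g <- G) contour_integral g f.

Definition two_pi_i : C := (pi *+ 2)%:C * 'i.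

Definition winding_number (G : seq (R -> C)) (mu : C) : C :=
  two_pi_i^-1 * cycle_integral G (fun z : C => (z - mu)^-1 : C).

Definition separating_contour (X : normedModType C) (A : X -> X) (L : set C)
    (G : seq (R -> C)) : Prop :=
  (forall g, g \in G -> closed_lipschitz_curve g) /\
  (forall g t, g \in G -> 0 <= t <= 1 -> ~ spectrum A (g t)) /\
  (forall mu, L mu -> winding_number G mu = 1) /\
  (forall mu, (spectrum A `\` L) mu -> winding_number G mu = 0).

Definition spectral_projection (X : normedModType C) (A : X -> X)
    (G : seq (R -> C)) (x : X) : X :=
  - (two_pi_i^-1 *: cycle_integral G (fun l => resolvent A l x)).

End Defs.

(* Main.v *)
(* Put [Q(m) = (2 pi i)^-1 \oint_G (z - m)^-1 R_z(A) dz] for [m] off the contour. Then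
   [(A - m) Q(m) = w(m) - P], where [w] is the winding number, which is 1 on [L], 0 on the rest of
   the spectrum, and locally constant. So the equation [(A - m) f(m) = P (1 - P) x] is solved by
   [R_m(A) P (1 - P) x] off the spectrum, by [Q(m) P x] near [L] and by [- Q(m) (1 - P) x] near the
   rest of the spectrum. These solutions glue to an entire function that vanishes at infinity,
   hence is 0 by Liouville, and [P] is idempotent. Finally [S = - Q(0)] (if 0 is in the spectrum)
   or [S = R_0(A)] commutes with [A] and satisfies [A S P = P], so [B = S P] is the Mary inverse. *)
Require Import Defs.
From HB Require Import structures.
From mathcomp Require Import all_boot all_order all_algebra.
From mathcomp Require Import all_classical all_reals all_analysis.
From mathcomp Require Import complex.
From mathcomp Require Import ring lra.
Import Order.TTheory GRing.Theory Num.Theory.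
Import numFieldNormedType.Exports.
Local Open Scope classical_set_scope.
Local Open Scope ring_scope.

Set Implicit Arguments.
Unset Strict Implicit.
Unset Printing Implicit Defensive.

(** The usual proof that [P] is idempotent multiplies two integrals over disjoint nested contours.
    Here a single cycle is given, known only through its winding numbers on the spectrum, so there
    is no second contour at hand. The right-hand side [P (1 - P) x] carries both factors because
    [(A - m) Q(m)] is [1 - P] near [L] and [- P] near the rest of the spectrum: each region solves
    the equation by means of one factor, and uniqueness off the spectrum makes the solutions agree.
    Decay at infinity is read off from the equation itself. Analyticity is encoded by bounds on
    differences at three points, which for [R_m(A)] and [Q(m)] come from algebraic identities;
    Liouville's theorem follows by averaging over regular polygons. Local constancy of the winding
    number comes from a quadratic bound on its increments, summed over the pieces of a finely cut
    segment. *)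

Local Notation "r %:C" := (real_complex _ r).

(** * Real-valued norms and sequential limits *)

Section RealNorm.
Variable R : realType.
Local Notation C := (CC R).

(* Norms over [C] take their values in [C], which is only partially ordered. *)
Definition nrm (V : normedModType C) (x : V) : R := complex.Re `|x|.

Section Vector.
Variable V : normedModType C.
Implicit Types (x y z : V) (a : C).

Lemma nrmE x : `|x| = (nrm x)%:C :> C.
Proof. by rewrite /nrm (@RRe_real R) ?normr_real. Qed.

Lemma nrm_ge0 x : 0 <= nrm x.
Proof. by have := normr_ge0 x; rewrite nrmE (@ler0c R). Qed.

Lemma nrm0 : nrm (0 : V) = 0.
Proof. by rewrite /nrm normr0. Qed.

Lemma nrm0_eq0 x : nrm x = 0 -> x = 0.
Proof. by move=> x0; apply/eqP; rewrite -normr_eq0 nrmE x0. Qed.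

Lemma nrm_gt0 x : x != 0 -> 0 < nrm x.
Proof.
by move=> x0; rewrite lt_neqAle nrm_ge0 andbT eq_sym; apply: contra_neq x0 => /nrm0_eq0.
Qed.

Lemma nrmD x y : nrm (x + y) <= nrm x + nrm y.
Proof. by have := ler_normD x y; rewrite !nrmE -rmorphD /= (@lecR R). Qed.

Lemma nrmN x : nrm (- x) = nrm x.
Proof. by rewrite /nrm normrN. Qed.

Lemma nrmBC x y : nrm (x - y) = nrm (y - x).
Proof. by rewrite -nrmN opprB. Qed.

Lemma nrmB x y : nrm (x - y) <= nrm x + nrm y.
Proof. by rewrite -(nrmN y) nrmD. Qed.

Lemma nrm_sub_trans y x z : nrm (x - z) <= nrm (x - y) + nrm (y - z).
Proof. by rewrite (le_trans _ (nrmD _ _)) // addrA subrK. Qed.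

Lemma nrmZ a x : nrm (a *: x) = nrm a * nrm x.
Proof. by apply: (@complexI R); rewrite rmorphM /= -!nrmE normrZ. Qed.

Lemma nrm_sum n (F : 'I_n -> V) (K : R) :
  (forall i, nrm (F i) <= K) -> nrm (\sum_(i < n) F i) <= n%:R * K.
Proof.
elim: n F => [|n IH] F FK; first by rewrite big_ord0 nrm0 mul0r.
rewrite big_ord_recr /= (le_trans (nrmD _ _)) // -natr1 mulrDl mul1r.
by rewrite lerD // IH.
Qed.

End Vector.

Lemma nrm_real (r : R) : nrm (r%:C : C) = `|r|.
Proof. by rewrite /nrm normc_def /= expr0n addr0 sqrtr_sqr. Qed.

Lemma nrm1 : nrm (1 : C) = 1.
Proof. by rewrite /nrm normr1. Qed.

Lemma nrmM (a b : C) : nrm (a * b) = nrm a * nrm b.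
Proof. by apply: (@complexI R); rewrite rmorphM /= -!nrmE normrM. Qed.

Lemma nrmV (a : C) : nrm a^-1 = (nrm a)^-1.
Proof. by apply: (@complexI R); rewrite fmorphV /= -!nrmE normfV. Qed.

Lemma nrmX (a : C) n : nrm (a ^+ n) = nrm a ^+ n.
Proof. by elim: n => [|n IH]; rewrite ?expr0 ?nrm1 // !exprS nrmM IH. Qed.

Lemma nrm_Re (a : C) : `|complex.Re a| <= nrm a.
Proof.
by rewrite /nrm normc_def /= -(sqrtr_sqr (complex.Re a)) ler_wsqrtr // lerDl sqr_ge0.
Qed.

Lemma nrm_Im (a : C) : `|complex.Im a| <= nrm a.
Proof.
by rewrite /nrm normc_def /= -(sqrtr_sqr (complex.Im a)) ler_wsqrtr // lerDr sqr_ge0.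
Qed.

Lemma nrm_le_ReIm (a : C) : nrm a <= `|complex.Re a| + `|complex.Im a|.
Proof.
case: a => a b; rewrite /nrm normc_def /=.
rewrite -[leRHS]ger0_norm ?addr_ge0 // -sqrtr_sqr ler_wsqrtr //.
rewrite -(real_normK (num_real a)) -(real_normK (num_real b)).
have := normr_ge0 a; have := normr_ge0 b; nra.
Qed.

Section Limits.
Variable V : normedModType C.

Definition tends (u : nat -> V) (l : V) : Prop :=
  forall e : R, 0 < e -> exists n0, forall n, (n0 <= n)%N -> nrm (u n - l) < e.

(** Positivity in [C] forces the imaginary part to vanish, so complex and real epsilons are
    interchangeable. *)
Lemma eps_complex (e : C) : 0 < e -> exists2 r : R, 0 < r & e = r%:C.
Proof.
move=> e0; have er : e \is Num.real by rewrite gtr0_real.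
exists (complex.Re e); last by rewrite (@RRe_real R).
by move: e0; rewrite -{1}(@RRe_real R _ er) (@ltcR R).
Qed.

Lemma tendsP (u : nat -> V) l : tends u l <-> u @ \oo --> l.
Proof.
split=> [ul|/cvgrPdist_lt ul e e0].
  apply/cvgrPdist_lt => _ /eps_complex[r r0 ->].
  have [n0 H] := ul _ r0; exists n0 => //= n /H.
  by rewrite nrmE nrmBC (@ltcR R).
have [|n0 _ H] := ul e%:C; first by rewrite (@ltcR R).
exists n0 => n n0n; have /= := H n n0n.
by rewrite nrmE nrmBC (@ltcR R).
Qed.

Lemma tends_lim (u : nat -> V) l : tends u l -> lim (u @ \oo) = l.
Proof. by move=> /tendsP; apply: cvg_lim; exact: norm_hausdorff. Qed.

Lemma tends_unique (u : nat -> V) l m : tends u l -> tends u m -> l = m.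
Proof. by move=> /tends_lim <- /tends_lim. Qed.

Lemma ball_nrm (x y : V) (e : R) : ball x (e%:C : C) y <-> nrm (x - y) < e.
Proof. by rewrite -ball_normE /= nrmE (@ltcR R). Qed.

Lemma nbhs_nrm (x : V) (P : set V) :
  nbhs x P <-> exists2 e : R, 0 < e & forall y, nrm (x - y) < e -> P y.
Proof.
split=> [/nbhs_ballP[_ /eps_complex[r r0 ->] H]|[e e0 H]].
  by exists r => // y /ball_nrm /H.
apply/nbhs_ballP; exists (e%:C : C) => /=; first by rewrite (@ltcR R).
by move=> y /ball_nrm /H.
Qed.

Lemma tends_squeeze (u : nat -> V) l (K : R) :
  (forall n, (0 < n)%N -> nrm (u n - l) <= K / n%:R) -> tends u l.
Proof.
move=> H e e0.
have K0 : 0 <= K by have := H 1%N isT; rewrite divr1; apply: le_trans; exact: nrm_ge0.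
exists (Num.truncn (K / e)).+1 => n nn.
have n0 : (0 < n)%N by apply: leq_trans nn.
rewrite (le_lt_trans (H _ n0)) // ltr_pdivrMr ?ltr0n // mulrC -ltr_pdivrMr //.
by rewrite (lt_le_trans (truncnS_gt _)) // ler_nat.
Qed.

Lemma tendsD (u v : nat -> V) l m :
  tends u l -> tends v m -> tends (fun n => u n + v n) (l + m).
Proof. by move=> /tendsP ul /tendsP vm; apply/tendsP; exact: cvgD. Qed.

Lemma tends_cst (l : V) : tends (fun=> l) l.
Proof. by apply/tendsP; exact: cvg_cst. Qed.

Lemma tends_le (u : nat -> V) l (K : R) :
  tends u l -> (forall n, nrm (u n) <= K) -> nrm l <= K.
Proof.
move=> ul uK; apply/ler_addgt0Pr => e e0.
have [n0 /(_ n0 (leqnn _)) H] := ul _ e0.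
rewrite -[l](subrK (u n0)) (le_trans (nrmD _ _)) // addrC lerD //.
by rewrite nrmBC ltW.
Qed.

(** A predicate, so that the same integration lemmas serve scalar-valued and [X]-valued
    integrands. *)
Definition cauchy_complete : Prop := forall u : nat -> V,
  (forall e : R, 0 < e -> exists n0, forall m n, (n0 <= m)%N -> (n0 <= n)%N ->
     nrm (u m - u n) < e) -> exists l, tends u l.

End Limits.

Lemma complete_cauchy (X : completeNormedModType C) : cauchy_complete X.
Proof.
move=> u cu; exists (lim (u @ \oo)); apply/tendsP.
apply: cauchy_cvg; apply: cauchy_exP => _ /eps_complex[r r0 ->].
have [n0 H] := cu _ r0; exists (u n0); exists n0 => //= n nn.
by apply/ball_nrm; apply: H.
Qed.

Lemma cauchy_complete_CC : cauchy_complete C.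
Proof.
move=> u cu.
have cR (f : C -> R) : (forall a b, `|f a - f b| <= nrm (a - b)) ->
    cvgn (f \o u : nat -> R).
  move=> fle; apply: cauchy_cvg; apply: cauchy_exP => e e0.
  have [n0 H] := cu _ e0; exists (f (u n0)); exists n0 => //= n nn.
  by apply: le_lt_trans (H _ _ (leqnn _) nn); rewrite fle.
have /cvg_ex[/= a /cvgrPdist_lt ca] : cvgn (@complex.Re R \o u : nat -> R).
  by apply: cR => x y; rewrite -raddfB; exact: nrm_Re.
have /cvg_ex[/= b /cvgrPdist_lt cb] : cvgn (@complex.Im R \o u : nat -> R).
  by apply: cR => x y; rewrite -raddfB; exact: nrm_Im.
exists (Complex a b) => e e0.
have e20 : 0 < e / 2 by rewrite divr_gt0.
have [n1 _ H1] := ca _ e20; have [n2 _ H2] := cb _ e20.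
exists (maxn n1 n2) => n; rewrite geq_max => /andP[/H1/= h1 /H2/= h2].
apply: le_lt_trans (nrm_le_ReIm _) _.
rewrite !raddfB /= distrC [X in _ + X]distrC.
by rewrite [ltRHS]splitr ltrD.
Qed.

End RealNorm.

(** * Contour integrals along Lipschitz cycles *)

Section Integral.
Variable R : realType.
Local Notation C := (CC R).

Lemma nrm_sum_nat (V : normedModType C) a b (F : nat -> V) (K : R) :
  (forall i, (a <= i < b)%N -> nrm (F i) <= K) ->
  nrm (\sum_(a <= i < b) F i) <= (b - a)%N%:R * K.
Proof.
move=> FK; rewrite -{1}(add0n a) big_addn big_mkord; apply: nrm_sum => i.
by apply: FK; rewrite leq_addl addnC -ltn_subRL /=.
Qed.

(** The quantitative form of [bounded_op], between two possibly different spaces: maps such as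
    [fun c => c *: y] from [C] to [V] also have to be moved across the integral. *)
Definition blin (V W : normedModType C) (T : V -> W) : Prop :=
  (forall (a : C) x y, T (a *: x + y) = a *: T x + T y) /\
  exists2 K : R, 0 <= K & forall x, nrm (T x) <= K * nrm x.

Section BlinTheory.
Variables (V W : normedModType C) (T : V -> W).
Hypothesis bT : blin T.

Lemma blinD x y : T (x + y) = T x + T y.
Proof. by have := bT.1 1 x y; rewrite !scale1r. Qed.

Lemma blin0 : T 0 = 0.
Proof. by apply: (addIr (T 0)); rewrite -blinD !add0r. Qed.

Lemma blinZ a x : T (a *: x) = a *: T x.
Proof. by have := bT.1 a x 0; rewrite !addr0 blin0 addr0. Qed.

Lemma blinN x : T (- x) = - T x.
Proof. by rewrite -scaleN1r blinZ scaleN1r. Qed.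

Lemma blinB x y : T (x - y) = T x - T y.
Proof. by rewrite blinD blinN. Qed.

Lemma blin_sum (I : Type) (r : seq I) (F : I -> V) :
  T (\sum_(i <- r) F i) = \sum_(i <- r) T (F i).
Proof. exact: (big_morph T blinD blin0). Qed.

Lemma tends_blin (u : nat -> V) l : tends u l -> tends (T \o u) (T l).
Proof.
case: bT => _ [K K0 TK] ul e e0.
have e1 : 0 < e / (K + 1) by rewrite divr_gt0 // ltr_wpDl.
have [n0 H] := ul _ e1; exists n0 => n /H /=; rewrite -blinB => ule.
rewrite (le_lt_trans (TK _)) // (@le_lt_trans _ _ ((K + 1) * nrm (u n - l))) //.
  by rewrite ler_wpM2r ?nrm_ge0 // lerDl.
by rewrite mulrC -ltr_pdivlMr // ltr_wpDl.
Qed.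

End BlinTheory.

Lemma blin_scale (V : normedModType C) (c : C) : blin (fun x : V => c *: x).
Proof.
split=> [a x y|]; first by rewrite scalerDr !scalerA mulrC.
by exists (nrm c) => [|x]; rewrite ?nrm_ge0 // nrmZ.
Qed.

Lemma blin_scalel (V : normedModType C) (y : V) : blin (fun c : C => c *: y).
Proof.
split=> [a x z|]; first by rewrite scalerDl scalerA.
by exists (nrm y) => [|x]; rewrite ?nrm_ge0 // nrmZ mulrC.
Qed.

Lemma blin_comp (U V W : normedModType C) (S : V -> W) (T : U -> V) :
  blin S -> blin T -> blin (S \o T).
Proof.
move=> bS bT; split=> [a x y|]; first by rewrite /= bT.1 bS.1.
case: bS bT => _ [K K0 SK] [_ [M M0 TM]]; exists (K * M) => [|x]; first exact: mulr_ge0.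
by rewrite -mulrA (le_trans (SK _)) // ler_wpM2l.
Qed.

Lemma bounded_opP (X : normedModType C) (T : X -> X) : bounded_op T <-> blin T.
Proof.
split=> [[lT cT]|bT].
  split=> //.
  have T0 : T 0 = 0.
    by have := lT 1 0 0; rewrite !scale1r addr0 => /eqP; rewrite eq_sym -subr_eq0 addrK => /eqP.
  have TZ a x : T (a *: x) = a *: T x by have := lT a x 0; rewrite T0 !addr0.
  have /nbhs_nrm[d d0 H] : nbhs (0 : X) (T @^-1` [set y | nrm y < 1]).
    apply: (cT 0); apply/nbhs_nrm; exists 1 => // y /=.
    by rewrite T0 sub0r nrmN.
  exists (2 / d) => [|x]; first by rewrite divr_ge0 // ltW.
  have [->|x0] := eqVneq x 0; first by rewrite T0 !nrm0 mulr0.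
  have nx := nrm_gt0 x0.
  (* [r] scales [x] to norm [d / 2], inside the ball that [T] maps into the unit ball; hence the
     constant [2 / d]. *)
  pose r : R := d / (2 * nrm x).
  have r0 : 0 < r by rewrite divr_gt0 // mulr_gt0.
  have := H (r%:C *: x); rewrite sub0r nrmN nrmZ nrm_real gtr0_norm // /= TZ nrmZ nrm_real.
  rewrite gtr0_norm // => /(_ _)/ltW h.
  have rx : r * nrm x = d / 2 by rewrite /r; field; rewrite gt_eqF.
  have : r * nrm (T x) <= 1 by apply: h; rewrite rx ltr_pdivrMr // ltr_pMr // ltr1n.
  rewrite -ler_pdivlMl // mulr1 => /le_trans; apply.
  by rewrite /r invf_div mulrAC.
split; first exact: bT.1.
move=> x; apply/cvgrPdist_lt => _ /eps_complex[e e0 ->].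
case: (bT) => _ [K K0 TK].
have K1 : 0 < K + 1 by rewrite ltr_wpDl.
near=> y; rewrite -(blinB bT) nrmE (@ltcR R) (le_lt_trans (TK _)) //.
have : nrm (x - y) < e / (K + 1).
  near: y; apply/nbhs_nrm; exists (e / (K + 1)) => //; exact: divr_gt0.
rewrite ltr_pdivlMr // mulrC; apply: le_lt_trans.
by rewrite ler_wpM2r ?nrm_ge0 // lerDl.
Unshelve. all: by end_near.
Qed.

(** * Convergence of Riemann-Stieltjes sums *)

Section Contour.
Variables (V : normedModType C) (g : R -> C) (f : C -> V).

Definition rsum (n : nat) : V := \sum_(j < n)
  (g (j.+1%:R / n%:R) - g (j%:R / n%:R)) *: f (g (j%:R / n%:R)).

(** Lipschitz in the parameter rather than in the point, so that only values of [f] on the curve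
    matter. *)
Definition lip_along : Prop := exists K : R, forall s t : R,
  0 <= s <= 1 -> 0 <= t <= 1 -> nrm (f (g s) - f (g t)) <= K * `|s - t|.

End Contour.

Lemma unit_frac (j n : nat) : (j <= n)%N -> 0 <= (j%:R / n%:R : R) <= 1.
Proof.
case: n => [|n] jn; first by rewrite invr0 mulr0 lexx ler01.
by rewrite divr_ge0 //= ler_pdivrMr ?ltr0n // mul1r ler_nat.
Qed.

Lemma closed_lipschitz_lip (g : R -> C) : closed_lipschitz_curve g ->
  lip_along g (fun z : C => z : C).
Proof.
case=> _ [K H]; exists K => s t s1 t1; have := H s t s1 t1.
by rewrite nrmE -rmorphM /= (@lecR R).
Qed.

Lemma lip_ge0 (V : normedModType C) (g : R -> C) (f : C -> V) (K : R) :
  (forall s t : R, 0 <= s <= 1 -> 0 <= t <= 1 ->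
    nrm (f (g s) - f (g t)) <= K * `|s - t|) -> 0 <= K.
Proof.
move=> /(_ 0 1); rewrite !lexx !ler01 sub0r normrN normr1 mulr1 => H.
exact: le_trans (nrm_ge0 _) (H isT isT).
Qed.

Lemma curve_step (g : R -> C) (K : R) :
  (forall s t : R, 0 <= s <= 1 -> 0 <= t <= 1 -> nrm (g s - g t) <= K * `|s - t|) ->
  forall j n, (j < n)%N -> nrm (g (j.+1%:R / n%:R) - g (j%:R / n%:R)) <= K / n%:R.
Proof.
move=> gK j n jn; rewrite (le_trans (gK _ _ (unit_frac _) (unit_frac _))) //; first exact: ltnW.
have -> : j.+1%:R / n%:R - j%:R / n%:R = n%:R^-1 :> R.
  by rewrite -mulrBl -natrB // subSnn mul1r.
by rewrite ger0_norm // invr_ge0 ler0n.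
Qed.

(** Each coarse increment of [g] telescopes into [m] fine ones, so the sums differ only in where [f]
    is evaluated, by at most [M / n], while the fine increments have total length at most [K]. The
    bound does not depend on [m]. *)
Lemma rsum_refine (V : normedModType C) (g : R -> C) (f : C -> V) (K M : R) n m :
  (forall s t : R, 0 <= s <= 1 -> 0 <= t <= 1 -> nrm (g s - g t) <= K * `|s - t|) ->
  (forall s t : R, 0 <= s <= 1 -> 0 <= t <= 1 ->
    nrm (f (g s) - f (g t)) <= M * `|s - t|) ->
  (0 < n)%N -> (0 < m)%N ->
  nrm (rsum g f n - rsum g f (n * m)) <= K * M / n%:R.
Proof.
move=> gK fM n0 m0; set N := (n * m)%N.
have N0 : (0 < N)%N by rewrite muln_gt0 n0.
have K0 : 0 <= K by exact: (@lip_ge0 _ g (fun z : C => z : C)).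
have M0 : 0 <= M by exact: lip_ge0 fM.
pose p (j : nat) := g (j%:R / N%:R).
have pE (i : nat) : g (i%:R / n%:R) = p (i * m)%N.
  by rewrite /p /N !natrM; congr g; field; rewrite !pnatr_eq0 -!lt0n n0 m0.
have -> : rsum g f n = \sum_(0 <= i < n) \sum_(i * m <= j < i.+1 * m)
    (p j.+1 - p j) *: f (p (i * m)%N).
  rewrite /rsum big_mkord; apply: eq_bigr => i _.
  by rewrite -scaler_suml telescope_sumr ?leq_mul2r ?leqnSn ?orbT // !pE.
have -> : rsum g f N = \sum_(0 <= i < n) \sum_(i * m <= j < i.+1 * m)
    (p j.+1 - p j) *: f (p j).
  by rewrite -big_nat_mul /rsum big_mkord.
rewrite -sumrB.
have -> : K * M / n%:R = (n - 0)%N%:R * (m%:R * (K / N%:R * (M / n%:R))).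
  by rewrite subn0 /N natrM; field; rewrite !pnatr_eq0 -!lt0n n0 m0.
apply: nrm_sum_nat => i /andP[_ lin]; rewrite -sumrB.
have -> : (m%:R : R) = (i.+1 * m - i * m)%N%:R by rewrite mulSn addnK.
apply: nrm_sum_nat => j /andP[ij ji]; rewrite -scalerBr nrmZ.
have jN : (j < N)%N by apply: leq_trans ji _; rewrite leq_mul2r lin orbT.
rewrite ler_pM ?nrm_ge0 //; first exact: curve_step.
have imN : (i * m <= N)%N by rewrite (leq_trans ij) // ltnW.
rewrite (le_trans (fM _ _ (unit_frac imN) (unit_frac (ltnW jN)))) // ler_wpM2l //.
rewrite distrC -mulrBl -natrB // normrM !ger0_norm ?invr_ge0 //.
have -> : (n%:R^-1 : R) = m%:R / N%:R.
  by rewrite /N natrM; field; rewrite !pnatr_eq0 -!lt0n n0 m0.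
by rewrite ler_wpM2r ?invr_ge0 // ler_nat leq_subLR -mulSnr ltnW.
Qed.

Lemma rsum_tends (V : normedModType C) (g : R -> C) (f : C -> V) :
  cauchy_complete V -> closed_lipschitz_curve g -> lip_along g f ->
  tends (rsum g f) (contour_integral g f).
Proof.
move=> cV /closed_lipschitz_lip[K gK] [M fM].
have [|l ul] := cV (rsum g f); last first.
  by rewrite /contour_integral -/(rsum g f) (tends_lim ul).
move=> e e0.
have K0 : 0 <= K by exact: lip_ge0 gK.
have M0 : 0 <= M by exact: lip_ge0 fM.
have e20 : 0 < e / 2 by rewrite divr_gt0.
have aux n : ((Num.truncn (K * M / (e / 2))).+1 <= n)%N -> K * M / n%:R < e / 2.
  move=> nn; have n0 : (0 < n)%N by apply: leq_trans nn.
  rewrite ltr_pdivrMr ?ltr0n // [ltRHS]mulrC -ltr_pdivrMr //.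
  by rewrite (lt_le_trans (truncnS_gt _)) // ler_nat.
exists (Num.truncn (K * M / (e / 2))).+1 => m n mm nn.
have m0 : (0 < m)%N by apply: leq_trans mm.
have n0 : (0 < n)%N by apply: leq_trans nn.
(* The uniform partitions into [m] and [n] pieces are compared through their common refinement into
   [m * n] pieces. *)
rewrite (le_lt_trans (nrm_sub_trans (rsum g f (m * n)) _ _)) // [ltRHS]splitr ltrD //.
  by rewrite (le_lt_trans (rsum_refine gK fM m0 n0)) // aux.
by rewrite nrmBC mulnC (le_lt_trans (rsum_refine gK fM n0 m0)) // aux.
Qed.

Lemma rsum_bound (V : normedModType C) (g : R -> C) (f : C -> V) (K B : R) n :
  (forall s t : R, 0 <= s <= 1 -> 0 <= t <= 1 -> nrm (g s - g t) <= K * `|s - t|) ->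
  (forall t, 0 <= t <= 1 -> nrm (f (g t)) <= B) ->
  nrm (rsum g f n) <= K * B.
Proof.
move=> gK fB.
have K0 : 0 <= K by exact: (@lip_ge0 _ g (fun z : C => z : C)).
have B0 : 0 <= B by rewrite (le_trans (nrm_ge0 _) (fB 0 _)) // lexx ler01.
have [->|n0] := eqVneq n 0%N; first by rewrite /rsum big_ord0 nrm0 mulr_ge0.
have -> : K * B = n%:R * (K / n%:R * B) by field; rewrite pnatr_eq0.
apply: nrm_sum => j; rewrite nrmZ ler_pM ?nrm_ge0 //; first exact: curve_step.
by apply: fB; apply: unit_frac; apply: ltnW.
Qed.

Lemma lip_bounded (V : normedModType C) (g : R -> C) (f : C -> V) :
  lip_along g f -> exists2 B : R, 0 <= B & forall t, 0 <= t <= 1 -> nrm (f (g t)) <= B.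
Proof.
case=> K fK; have K0 : 0 <= K by exact: lip_ge0 fK.
exists (nrm (f (g 0)) + K) => [|t t1]; first by rewrite addr_ge0 ?nrm_ge0.
rewrite -[f (g t)](addrNK (f (g 0))) addrC (le_trans (nrmD _ _)) // lerD2l.
rewrite (le_trans (fK _ _ t1 _)) ?lexx ?ler01 // ler_piMr // subr0.
by case/andP: t1 => t0 t1; rewrite ger0_norm.
Qed.

Lemma lip_scale (V : normedModType C) (g : R -> C) (u : C -> C) (f : C -> V) :
  lip_along g u -> lip_along g f -> lip_along g (fun z => u z *: f z).
Proof.
move=> lu lf; have [A A0 uA] := lip_bounded lu; have [B B0 fB] := lip_bounded lf.
case: lu lf => [K uK] [M fM]; exists (A * M + K * B) => s t s1 t1.
have -> : u (g s) *: f (g s) - u (g t) *: f (g t) =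
    u (g s) *: (f (g s) - f (g t)) + (u (g s) - u (g t)) *: f (g t).
  by rewrite scalerBr scalerBl addrA subrK.
rewrite (le_trans (nrmD _ _)) // !nrmZ mulrDl lerD //.
  by rewrite -mulrA ler_pM ?nrm_ge0 ?uA ?fM.
by rewrite mulrAC ler_pM ?nrm_ge0 ?uK ?fB.
Qed.

Lemma lip_add (V : normedModType C) (g : R -> C) (f h : C -> V) :
  lip_along g f -> lip_along g h -> lip_along g (fun z => f z + h z).
Proof.
move=> [K fK] [M hM]; exists (K + M) => s t s1 t1.
by rewrite opprD addrACA (le_trans (nrmD _ _)) // mulrDl lerD ?fK ?hM.
Qed.

Lemma lip_blin (V W : normedModType C) (T : V -> W) (g : R -> C) (f : C -> V) :
  blin T -> lip_along g f -> lip_along g (fun z => T (f z)).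
Proof.
move=> bT [M fM]; case: (bT) => _ [K K0 TK]; exists (K * M) => s t s1 t1.
by rewrite -(blinB bT) (le_trans (TK _)) // -mulrA ler_wpM2l ?fM.
Qed.

(** * Integrals over cycles *)

Section Cycle.
Variable G : seq (R -> C).
Hypothesis Gcl : forall g, g \in G -> closed_lipschitz_curve g.

Definition lip_on (V : normedModType C) (f : C -> V) : Prop :=
  forall g, g \in G -> lip_along g f.

Let csum (V : normedModType C) (f : C -> V) n := \sum_(g <- G) rsum g f n.

Lemma csum_tends (V : normedModType C) (f : C -> V) :
  cauchy_complete V -> lip_on f -> tends (csum f) (cycle_integral G f).
Proof.
move=> cV; rewrite /lip_on /csum /cycle_integral.
elim: G Gcl => [_ _|g s IH cl lf].
  by have := tends_cst (0 : V); congr tends; rewrite ?big_nil //;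
    apply/funext => n; rewrite big_nil.
rewrite big_cons.
have -> : (fun n => \sum_(h <- g :: s) rsum h f n) =
    (fun n => rsum g f n + \sum_(h <- s) rsum h f n).
  by apply/funext => n; rewrite big_cons.
apply: tendsD; first by apply: rsum_tends => //; [apply: cl|apply: lf]; rewrite mem_head.
by apply: IH => h hs; [apply: cl|apply: lf]; rewrite inE hs orbT.
Qed.

Lemma cycle_integral_map (V W : normedModType C) (T : V -> W) (f : C -> V) :
  cauchy_complete V -> cauchy_complete W -> blin T -> lip_on f ->
  cycle_integral G (fun z => T (f z)) = T (cycle_integral G f).
Proof.
move=> cV cW bT lf; apply: (@tends_unique _ _ (csum (fun z => T (f z)))).
  by apply: csum_tends => // g gG; apply: lip_blin => //; exact: lf.
have -> : csum (fun z => T (f z)) = T \o csum f.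
  apply/funext => n /=; rewrite /csum (blin_sum bT); apply: eq_bigr => g _.
  by rewrite /rsum (blin_sum bT); apply: eq_bigr => j _; rewrite (blinZ bT).
by apply: tends_blin => //; exact: csum_tends.
Qed.

Lemma cycle_integralD (V : normedModType C) (f h : C -> V) :
  cauchy_complete V -> lip_on f -> lip_on h ->
  cycle_integral G (fun z => f z + h z) = cycle_integral G f + cycle_integral G h.
Proof.
move=> cV lf lh; apply: (@tends_unique _ _ (csum (fun z => f z + h z))).
  by apply: csum_tends => // g gG; apply: lip_add; [exact: lf|exact: lh].
have -> : csum (fun z => f z + h z) = (fun n => csum f n + csum h n).
  apply/funext => n; rewrite /csum -big_split; apply: eq_bigr => g _.
  by rewrite /rsum -big_split; apply: eq_bigr => j _; rewrite /= -scalerDr.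
by apply: tendsD; exact: csum_tends.
Qed.

Lemma eq_cycle_integral (V : normedModType C) (f h : C -> V) :
  (forall g t, g \in G -> 0 <= t <= 1 -> f (g t) = h (g t)) ->
  cycle_integral G f = cycle_integral G h.
Proof.
move=> fh; apply: eq_big_seq => g gG; congr (lim (_ @ \oo)); apply/funext => n.
by apply: eq_bigr => j _; rewrite fh //; apply: unit_frac; exact: ltnW.
Qed.

(** The constant depends on the cycle alone and is fixed before [V] and [f], which gives bounds
    uniform in a parameter of the integrand. *)
Lemma cycle_integral_bound : exists2 K : R, 0 <= K &
  forall (V : normedModType C) (f : C -> V) (B : R), cauchy_complete V -> lip_on f ->
  0 <= B -> (forall g t, g \in G -> 0 <= t <= 1 -> nrm (f (g t)) <= B) ->
  nrm (cycle_integral G f) <= K * B.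
Proof.
rewrite /lip_on /cycle_integral.
elim: G Gcl => [_|g s IH cl].
  by exists 0 => // V f B _ _ B0 _; rewrite big_nil nrm0 mul0r.
have [|K K0 IHK] := IH; first by move=> h hs; apply: cl; rewrite inE hs orbT.
have gcl : closed_lipschitz_curve g by apply: cl; rewrite mem_head.
have [M gM] := closed_lipschitz_lip gcl.
have M0 : 0 <= M by exact: lip_ge0 gM.
exists (M + K) => [|V f B cV lf B0 fB]; first exact: addr_ge0.
rewrite big_cons (le_trans (nrmD _ _)) // mulrDl lerD //.
  apply: (tends_le (rsum_tends cV gcl _)); first by apply: lf; rewrite mem_head.
  by move=> n; apply: rsum_bound => // t; apply: fB; rewrite mem_head.
apply: IHK => // [h hs|h t hs]; first by apply: lf; rewrite inE hs orbT.
by apply: fB; rewrite inE hs orbT.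
Qed.

End Cycle.
End Integral.

(** * Winding numbers *)

Section Compactness.
Variable R : realType.

(** The near-covering form of compactness with the filter of neighbourhoods of infinity:
    monotonicity in [M] turns a bound near each point into a property of all large [M], which
    compactness makes uniform. *)
Lemma compact_uniform (T : topologicalType) (K : set T) (P : R -> T -> Prop) :
  compact K -> (forall M N t, M <= N -> P M t -> P N t) ->
  (forall t, K t -> exists M, nbhs t [set s | P M s]) ->
  exists2 M, 0 < M & forall t, K t -> P M t.
Proof.
move=> /compact_near_coveringP cK mono loc.
have [|M0 [M0r H]] := cK R (pinfty_nbhs R) P _.
  move=> t /loc[M tM]; exists ([set s | P M s], [set m | M < m]) => /=.
    by split=> //; exists M; split=> //; exact: num_real.
  by move=> [s m] /= [PM /ltW Mm]; exact: mono PM.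
exists (Num.max 1 (M0 + 1)); first by rewrite lt_max ltr01.
by apply: H; rewrite lt_max ltrDl ltr01 orbT.
Qed.

Lemma unit_uniform (P : R -> R -> Prop) :
  (forall M N t, M <= N -> P M t -> P N t) ->
  (forall t, 0 <= t <= 1 -> exists2 d, 0 < d &
    exists M, forall s, 0 <= s <= 1 -> `|t - s| < d -> P M s) ->
  exists2 M, 0 < M & forall t, 0 <= t <= 1 -> P M t.
Proof.
move=> mono loc; pose Q M t := 0 <= t <= 1 -> P M t.
have [|t|M M0 H] := @compact_uniform R^o `[0, 1]%classic Q (@segment_compact R 0 1).
- by move=> M N t MN PM t1; apply: mono MN _; exact: PM.
- rewrite /= in_itv /= => /loc[d d0 [M H]]; exists M.
  by apply/nbhs_ballP; exists d => // s /= ts s1; exact: H.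
- by exists M => // t t1; apply: (H t) => //=; rewrite in_itv.
Qed.

(** The disc lies in the square of half-side [r], compact as a product of segments. Since the norm
    is at most |Re| + |Im|, a box of half-side [d / 2] stays within distance [d]. *)
Lemma disc_uniform (r : R) (P : R -> CC R -> Prop) :
  (forall M N z, M <= N -> P M z -> P N z) ->
  (forall z, exists2 d, 0 < d & exists M, forall y, nrm (z - y) < d -> P M y) ->
  exists2 M, 0 < M & forall z, nrm z <= r -> P M z.
Proof.
move=> mono loc; pose Q M (p : R^o * R^o) := P M (Complex p.1 p.2).
have cK := compact_setX (@segment_compact R (- r) r) (@segment_compact R (- r) r).
have [M N t|[x y] _|M M0 H] := @compact_uniform _ _ Q cK; first exact: mono.
- have [d d0 [M H]] := loc (Complex x y); exists M.
  have d20 : 0 < d / 2 by rewrite divr_gt0.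
  apply/nbhs_ballP; exists (d / 2) => //= -[x' y'] [/= xx yy].
  apply: H; apply: le_lt_trans (nrm_le_ReIm _) _ => /=.
  by rewrite [ltRHS]splitr ltrD.
- exists M => // -[x y] zr; apply: (H (x, y)); split; rewrite /= in_itv /= -ler_norml.
    exact: le_trans (nrm_Re _) zr.
  exact: le_trans (nrm_Im _) zr.
Qed.

End Compactness.

(** * Distance to the cycle and local constancy of the winding number *)

Section Winding.
Variable R : realType.
Local Notation C := (CC R).
Variable G : seq (R -> C).
Hypothesis Gcl : forall g, g \in G -> closed_lipschitz_curve g.

Definition far (a : C) (d : R) : Prop :=
  forall g t, g \in G -> 0 <= t <= 1 -> d <= nrm (g t - a).

Lemma seq_uniform (P : R -> (R -> C) -> Prop) :
  (forall M N g, M <= N -> P M g -> P N g) ->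
  (forall g, g \in G -> exists M, P M g) ->
  exists2 M, 0 < M & forall g, g \in G -> P M g.
Proof.
move=> mono; elim: G => [_|g s IH loc]; first by exists 1.
have [|M M0 HM] := IH; first by move=> h hs; apply: loc; rewrite inE hs orbT.
have [|N HN] := loc g; first by rewrite mem_head.
exists (Num.max M N) => [|h]; first by rewrite lt_max M0.
by rewrite inE => /orP[/eqP ->|/HM Ph];
  [apply: mono HN|apply: mono Ph]; rewrite le_max lexx ?orbT.
Qed.

Lemma curve_near (g : R -> C) (t d : R) : g \in G -> 0 <= t <= 1 -> 0 < d ->
  exists2 e, 0 < e & forall s, 0 <= s <= 1 -> `|t - s| < e -> nrm (g t - g s) < d.
Proof.
move=> /Gcl /closed_lipschitz_lip[K gK] t1 d0.
have K0 : 0 <= K by exact: lip_ge0 gK.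
exists (d / (K + 1)) => [|s s1]; first by rewrite divr_gt0 // ltr_wpDl.
rewrite ltr_pdivlMr ?ltr_wpDl // mulrC; apply: le_lt_trans.
by rewrite (le_trans (gK _ _ t1 s1)) // ler_wpM2r // lerDl.
Qed.

Lemma far_exists (a : C) : (forall g t, g \in G -> 0 <= t <= 1 -> g t <> a) ->
  exists2 d, 0 < d & far a d.
Proof.
move=> Ga.
(* The uniformity lemmas need a property preserved when [M] grows, so the lower bound on the
   distance is sought as an upper bound [M] on its inverse. *)
have [|g gG|M M0 H] := @seq_uniform (fun M g =>
    forall t, 0 <= t <= 1 -> 1 <= M * nrm (g t - a)).
- by move=> M N g MN PM t t1; rewrite (le_trans (PM t t1)) // ler_wpM2r ?nrm_ge0.
- have [|t t1|M M0 H] := @unit_uniform _ (fun M t => 1 <= M * nrm (g t - a)).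
  + by move=> M N t MN; move=> /le_trans; apply; rewrite ler_wpM2r ?nrm_ge0.
  + have ta : 0 < nrm (g t - a) by apply: nrm_gt0; rewrite subr_eq0; apply/eqP; exact: Ga.
    have [|e e0 He] := curve_near (d := nrm (g t - a) / 2) gG t1; first by rewrite divr_gt0.
    exists e => //; exists (2 / nrm (g t - a)) => s s1 /(He _ s1) h.
    rewrite mulrAC ler_pdivlMr // mul1r.
    by have := nrm_sub_trans (g s) (g t) a; lra.
  + by exists M.
- exists M^-1; first by rewrite invr_gt0.
  by move=> g t gG t1; rewrite -[M^-1]mul1r ler_pdivrMr // mulrC; apply: H.
Qed.

Lemma far_neq (a : C) d g t : 0 < d -> far a d -> g \in G -> 0 <= t <= 1 -> g t - a != 0.
Proof.
move=> d0 ad gG t1; have := ad _ _ gG t1; apply: contraTneq => ->.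
by rewrite nrm0 -ltNge.
Qed.

Lemma far_near (a b : C) d : far a d -> nrm (a - b) <= d / 2 -> far b (d / 2).
Proof.
move=> ad ab g t gG t1; have := ad _ _ gG t1.
by have := nrm_sub_trans b (g t) a; rewrite (nrmBC b); lra.
Qed.

Lemma far_inv (a : C) d g t : 0 < d -> far a d -> g \in G -> 0 <= t <= 1 ->
  nrm (g t - a)^-1 <= d^-1.
Proof.
move=> d0 ad gG t1; have ta := nrm_gt0 (far_neq d0 ad gG t1).
by rewrite nrmV lef_pV2 ?posrE //; exact: ad.
Qed.

Lemma lip_inv (a : C) d : 0 < d -> far a d -> lip_on G (fun z : C => (z - a)^-1 : C).
Proof.
move=> d0 ad g gG; have [K gK] := closed_lipschitz_lip (Gcl gG).
exists (K * (d^-1 * d^-1)) => s t s1 t1.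
have sa := far_neq d0 ad gG s1; have ta := far_neq d0 ad gG t1.
have -> : (g s - a)^-1 - (g t - a)^-1 = (g t - g s) * ((g s - a)^-1 * (g t - a)^-1).
  by field; rewrite sa ta.
rewrite !nrmM nrmBC mulrAC ler_pM ?nrm_ge0 ?mulr_ge0 ?nrm_ge0 ?gK //.
by rewrite ler_pM ?nrm_ge0 // (far_inv d0 ad).
Qed.

Lemma eq_sum_telescope (V : zmodType) (x y u : nat -> V) n : u 0%N = u n ->
  (forall j, (j < n)%N -> x j = y j + (u j - u j.+1)) ->
  \sum_(j < n) x j = \sum_(j < n) y j.
Proof.
move=> u0n xE; under eq_bigr => j _ do rewrite xE ?ltn_ord // -opprB.
rewrite sumrB -(big_mkord xpredT (fun j => u j.+1 - u j)) telescope_sumr //.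
by rewrite u0n subrr subr0.
Qed.

(* [(z - a)^-2] has the primitive [- (z - a)^-1] *)
Lemma cycle_integral_inv_sqr (a : C) d : 0 < d -> far a d ->
  cycle_integral G (fun z : C => (z - a)^-1 * (z - a)^-1 : C) = 0.
Proof.
move=> d0 ad; rewrite /cycle_integral big1_seq // => g /= gG.
have [K gK] := closed_lipschitz_lip (Gcl gG).
have K0 : 0 <= K by exact: lip_ge0 gK.
suff /tends_lim : tends (rsum g (fun z : C => (z - a)^-1 * (z - a)^-1 : C)) 0 by [].
apply: (@tends_squeeze _ _ _ _ (K * K * (d^-1 * d^-1 * d^-1))) => n n0.
rewrite subr0 /rsum; pose p j := g (j%:R / n%:R); pose u j := (p j - a)^-1.
have pa j : (j <= n)%N -> p j - a != 0 by move=> jn; exact: (far_neq d0 ad gG (unit_frac _ jn)).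
(* Each term is exactly the increment [u j - u j.+1] of the primitive plus a remainder quadratic in
   the step. The increments cancel because the curve is closed, and [n] remainders of order
   [1 / n^2] tend to 0. *)
have -> : \sum_(j < n) (p j.+1 - p j) *: ((p j - a)^-1 * (p j - a)^-1) =
    \sum_(j < n) ((p j.+1 - p j) * (p j.+1 - p j) * (u j * u j * u j.+1)).
  apply: (@eq_sum_telescope C (fun j => (p j.+1 - p j) * ((p j - a)^-1 * (p j - a)^-1))
    (fun j => (p j.+1 - p j) * (p j.+1 - p j) * (u j * u j * u j.+1)) u) => [|j jn].
    rewrite /u /p mul0r divff ?pnatr_eq0 -?lt0n //.
    by case: (Gcl gG) => ->.
  have h1 := pa j (ltnW jn); have h2 := pa j.+1 jn.
  by rewrite /u; field; rewrite h1 h2.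
have -> : K * K * (d^-1 * d^-1 * d^-1) / n%:R =
    n%:R * ((K / n%:R) * (K / n%:R) * (d^-1 * d^-1 * d^-1)).
  by field; rewrite pnatr_eq0 -lt0n n0 gt_eqF.
apply: nrm_sum => j; rewrite !nrmM.
have st : nrm (p j.+1 - p j) <= K / n%:R by exact: curve_step.
have ub i : (i <= n)%N -> nrm (u i) <= d^-1.
  by move=> i_n; exact: (far_inv d0 ad gG (unit_frac _ i_n)).
have uj := ub j (ltnW (ltn_ord j)); have uj1 := ub _ (ltn_ord j).
by rewrite !ler_pM ?mulr_ge0 ?nrm_ge0.
Qed.

Lemma blin_mul (c : C) : blin (fun x : C => c * x : C).
Proof. exact: blin_scale. Qed.

Lemma lip_mul (g : R -> C) (u v : C -> C) :
  lip_along g u -> lip_along g v -> lip_along g (fun z => u z * v z : C).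
Proof. exact: lip_scale. Qed.

(** Expanding [(z - c)^-1] around [b], the first-order term is a multiple of [(z - b)^-2] and
    integrates to 0; what is left is [(c - b)^2] times the integral of [(z - c)^-1 (z - b)^-2]. *)
Lemma winding_quadratic (a : C) d : 0 < d -> far a d -> exists2 K : R, 0 <= K &
  forall b c, nrm (a - b) <= d / 2 -> nrm (a - c) <= d / 2 ->
  nrm (winding_number G c - winding_number G b) <= K * (nrm (c - b) * nrm (c - b)).
Proof.
move=> d0 ad; have [K K0 HK] := cycle_integral_bound Gcl.
pose e := d / 2; have e0 : 0 < e by rewrite divr_gt0.
exists (nrm (two_pi_i R)^-1 * (K * (e^-1 * e^-1 * e^-1))).
  by rewrite !mulr_ge0 ?nrm_ge0 ?invr_ge0 // ltW.
move=> b c ab ac; have bd := far_near ad ab; have cd := far_near ad ac.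
have lb := lip_inv e0 bd; have lc := lip_inv e0 cd.
rewrite /winding_number -mulrBr nrmM -mulrA ler_wpM2l ?nrm_ge0 //.
have cC : cauchy_complete C := @cauchy_complete_CC R.
pose u (a z : C) : C := (z - a)^-1.
have lbb : lip_on G (fun z => u b z * (u b z )) by move=> g gG; apply: lip_mul; exact: lb.
have lbbc : lip_on G (fun z => u c z * (u b z * (u b z ))).
  by move=> g gG; apply: lip_mul; [exact: lc|exact: lbb].
have -> : cycle_integral G (u c) = cycle_integral G (fun z => u b z +
    ((c - b) * (u b z * u b z) + ((c - b) * (c - b)) * (u c z * (u b z * (u b z ))))).
  apply: eq_cycle_integral => g t gG t1.
  have h1 := far_neq e0 bd gG t1; have h2 := far_neq e0 cd gG t1.
  by rewrite /u; field; rewrite h1 h2.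
rewrite cycle_integralD //; last first.
  by move=> g gG; apply: lip_add;
    [exact: (lip_blin (blin_mul _) (lbb g gG))|exact: (lip_blin (blin_mul _) (lbbc g gG))].
rewrite cycle_integralD //; last 2 first.
- by move=> g gG; exact: (lip_blin (blin_mul _) (lbb g gG)).
- by move=> g gG; exact: (lip_blin (blin_mul _) (lbbc g gG)).
rewrite (cycle_integral_map _ cC cC (blin_mul _)) // (cycle_integral_inv_sqr e0 bd).
rewrite mulr0 add0r (cycle_integral_map _ cC cC (blin_mul _)) //.
rewrite addrAC subrr add0r !nrmM mulrC ler_wpM2r ?mulr_ge0 ?nrm_ge0 //.
apply: HK => //; first by rewrite !mulr_ge0 // invr_ge0 ltW.
move=> g t gG t1; rewrite !nrmM.
have h1 := far_inv e0 bd gG t1; have h2 := far_inv e0 cd gG t1.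
by rewrite -mulrA !ler_pM ?mulr_ge0 ?nrm_ge0.
Qed.

(** Cutting the segment from [a] to [b] into [n] equal pieces bounds the change of [F] by
    [n * K (h / n)^2], which tends to 0. *)
Lemma quadratic_cst (V : normedModType C) (F : C -> V) (a b : C) (d K : R) :
  (forall x y, nrm (a - x) <= d -> nrm (a - y) <= d ->
    nrm (F y - F x) <= K * (nrm (y - x) * nrm (y - x))) ->
  nrm (a - b) <= d -> F b = F a.
Proof.
move=> FK ab; set h := nrm (a - b) in ab.
pose p n j := a + (j%:R / n%:R : R)%:C * (b - a).
apply: (@tends_unique _ _ (fun n => F (p n n))).
  apply: (@tends_squeeze _ _ _ _ 0) => n n0.
  by rewrite /p divff ?pnatr_eq0 -?lt0n // rmorph1 mul1r [a + _]addrC subrK subrr nrm0 mul0r.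
apply: (@tends_squeeze _ _ _ _ (K * (h * h))) => n n0.
have -> : F a = F (p n 0%N) by rewrite /p mul0r rmorph0 mul0r addr0.
rewrite -(telescope_sumr (fun j => F (p n j))) // big_mkord.
have -> : K * (h * h) / n%:R = n%:R * (K * (h / n%:R * (h / n%:R))).
  by field; rewrite pnatr_eq0 -lt0n n0.
have pd j : (j <= n)%N -> nrm (a - p n j) <= d.
  move=> jn; rewrite /p opprD addrA subrr sub0r nrmN nrmM nrm_real (nrmBC b) -/h.
  have /andP[j0 j1] := unit_frac R jn.
  by rewrite ger0_norm // (le_trans _ ab) // ler_piMl // nrm_ge0.
apply: nrm_sum => j; have -> : h / n%:R = nrm (p n j.+1 - p n j); last first.
  by apply: FK; apply: pd => //; exact: ltnW.
rewrite /p opprD addrACA subrr add0r -mulrBl -rmorphB -mulrBl -natrB // subSnn.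
by rewrite nrmM nrm_real mul1r ger0_norm ?invr_ge0 // (nrmBC b) mulrC.
Qed.

Lemma winding_locally_cst (a b : C) d : 0 < d -> far a d -> nrm (a - b) <= d / 2 ->
  winding_number G b = winding_number G a.
Proof.
move=> d0 ad; have [K K0 H] := winding_quadratic d0 ad.
exact: quadratic_cst H.
Qed.

End Winding.

(** * Liouville's theorem *)

Section Liouville.
Variable R : realType.
Local Notation C := (CC R).

Lemma nrm_sqr (a : C) : nrm a ^+ 2 = complex.Re a ^+ 2 + complex.Im a ^+ 2.
Proof. by rewrite /nrm normc_def /= sqr_sqrtr // addr_ge0 // sqr_ge0. Qed.

Lemma nrm_unity (w : C) n : (0 < n)%N -> nrm (w ^+ n) = 1 -> nrm w = 1.
Proof.
move=> n0; rewrite nrmX => /eqP.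
by rewrite -{1}(expr1n R n) eqrXn2 ?nrm_ge0 // => /eqP.
Qed.

(** Iterated square roots of -1, always taking the root nearer to 1. If [v ^+ 2 = w] with [v] of
    norm 1, the squared distances of [v] to 1 and -1 add up to 4 and have product
    [nrm (w - 1) ^+ 2]; the larger is at least 2, so the smaller is at most half of
    [nrm (w - 1) ^+ 2]. The value -1 of the power [2 ^ k] rules out [w = 1]. *)
Lemma small_unity_root (e : R) : 0 < e ->
  exists n (w : C), [/\ (0 < n)%N, w ^+ n = 1, w != 1 & nrm (w - 1) < e].
Proof.
move=> e0.
have root k : exists2 w : C, w ^+ (2 ^ k) = -1 & nrm (w - 1) ^+ 2 <= 4 / (2 ^ k)%:R.
  elim: k => [|k [w wk w1]].
    exists (-1); rewrite ?expr1 // divr1 nrm_sqr /=; lra.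
  pose s : C := sqrtc w; have s2 : s ^+ 2 = w := sqr_sqrtc w.
  have step (v : C) : v ^+ 2 = w -> nrm (v - 1) ^+ 2 <= nrm (v + 1) ^+ 2 ->
      nrm (v - 1) ^+ 2 <= 4 / (2 ^ k.+1)%:R.
    move=> v2 vle.
    have nv : nrm v = 1.
      apply: (@nrm_unity _ (2 ^ k.+1)); first by rewrite expn_gt0.
      by rewrite expnS exprM v2 wk nrmN nrm1.
    have par : nrm (v - 1) ^+ 2 + nrm (v + 1) ^+ 2 = 4.
      have : nrm v ^+ 2 = 1 by rewrite nv expr1n.
      by rewrite !nrm_sqr !raddfB !raddfD /=; lra.
    have prod : nrm (v - 1) ^+ 2 * nrm (v + 1) ^+ 2 = nrm (w - 1) ^+ 2.
      by rewrite -exprMn -nrmM -v2; congr (nrm _ ^+ 2); ring.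
    have := sqr_ge0 (nrm (v - 1)).
    rewrite expnS natrM invfM mulrCA ler_pdivlMl // => h0.
    by apply: le_trans w1; rewrite -prod; nra.
  have [|/ltW] := leP (nrm (s - 1) ^+ 2) (nrm (s + 1) ^+ 2) => hs.
    exists s; last exact: step.
    by rewrite expnS exprM s2.
  exists (- s); first by rewrite expnS exprM sqrrN s2.
  apply: step; first by rewrite sqrrN.
  by rewrite -opprD nrmN -(nrmN (- s + 1)) opprD opprK.
have [w wk w1] := root (Num.truncn (4 / e ^+ 2)).+1.
set k := (Num.truncn _).+1 in wk w1.
exists (2 ^ k.+1)%N, w; split; rewrite ?expn_gt0 //.
- by rewrite expnSr exprM wk sqrrN expr1n.
- apply/eqP => w_1; move: wk; rewrite w_1 expr1n => /eqP.
  by rewrite -subr_eq0 opprK -[1 + 1]/(2%:R) pnatr_eq0.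
- rewrite -(ltr_pXn2r (n := 2)) ?nnegrE ?nrm_ge0 ?ltW // (le_lt_trans w1) //.
  rewrite ltr_pdivrMr ?ltr0n ?expn_gt0 // mulrC -ltr_pdivrMr ?exprn_gt0 //.
  by rewrite (lt_trans (truncnS_gt _)) // ltr_nat ltn_expl.
Qed.

Variable X : normedModType C.
Implicit Type f : C -> X.

(* The second bound says that difference quotients of [f] at [a] agree to first order. *)
Definition holo_bound f (M : R) (a b c : C) : Prop :=
  nrm (f b - f a) <= M * nrm (b - a) /\
  nrm ((c - a) *: (f b - f a) - (b - a) *: (f c - f a)) <=
    M * (nrm (b - a) * nrm (c - a) * nrm (b - c)).

(** The base point [a] varies too: the second divided difference is bounded at all triples near [z],
    with one constant. *)
Definition holo_at f (z : C) : Prop := exists2 d : R, 0 < d & exists M, forall a b c,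
  nrm (z - a) < d -> nrm (z - b) < d -> nrm (z - c) < d -> holo_bound f M a b c.

Lemma holo_bound_le f M N a b c : M <= N -> holo_bound f M a b c -> holo_bound f N a b c.
Proof.
move=> MN [h1 h2]; split; [apply: le_trans h1 _|apply: le_trans h2 _];
  by rewrite ler_wpM2r ?mulr_ge0 ?nrm_ge0.
Qed.

(** A single [M] is both the bound and the inverse of the radius, so that the property weakens as
    [M] grows, as [disc_uniform] requires. *)
Lemma holo_uniform f (r : R) : (forall z, holo_at f z) ->
  exists2 M, 0 < M & forall a b c, nrm a <= r ->
    M * nrm (a - b) < 1 -> M * nrm (a - c) < 1 -> holo_bound f M a b c.
Proof.
move=> fh.
have [M N z MN H b c bz cz|z|M M0 H] := @disc_uniform R r (fun M a => forall b c,
  M * nrm (a - b) < 1 -> M * nrm (a - c) < 1 -> holo_bound f M a b c).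
- apply: (holo_bound_le MN); apply: H;
    [apply: le_lt_trans bz|apply: le_lt_trans cz]; by rewrite ler_wpM2r ?nrm_ge0.
- have [d d0 [M H]] := fh z; exists (d / 2); first by rewrite divr_gt0.
  exists (Num.max M (2 / d)) => y zy b c yb yc.
  apply: (@holo_bound_le _ M); first by rewrite le_max lexx.
  have near t : Num.max M (2 / d) * nrm (y - t) < 1 -> nrm (z - t) < d.
    move=> yt; have : 2 / d * nrm (y - t) < 1.
      by apply: le_lt_trans yt; rewrite ler_wpM2r ?nrm_ge0 // le_max lexx orbT.
    rewrite mulrAC ltr_pdivrMr // mul1r.
    by have := nrm_sub_trans y z t; lra.
  apply: H; [|exact: near..]; lra.
- by exists M => // a b c /H; apply.
Qed.

(** * Means over regular polygons *)

Section Mean.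
Variables (f : C -> X) (n : nat) (w : C).
Hypotheses (n0 : (0 < n)%N) (wn : w ^+ n = 1) (w1 : w != 1).

Let p (r : R) k : C := r%:C * w ^+ k.
Let S (r : R) := \sum_(k < n) f (p r k).

Lemma nrm_wX k : nrm (w ^+ k) = 1.
Proof. by rewrite nrmX (@nrm_unity w n) ?expr1n // wn nrm1. Qed.

Lemma nrm_p r k : nrm (p r k) = `|r|.
Proof. by rewrite nrmM nrm_real nrm_wX mulr1. Qed.

(* Summed over the n-gon, the tangential differences telescope to 0,
   so the radial ones are small. *)
Lemma mean_step (M r0 r h : R) :
  (forall a b c, nrm a <= r0 -> M * nrm (a - b) < 1 -> M * nrm (a - c) < 1 ->
    holo_bound f M a b c) -> 0 <= M -> 0 < r -> r <= r0 -> 0 < h ->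
  M * h < 1 -> M * (r * nrm (w - 1)) < 1 ->
  nrm (S (r + h) - S r) <= n%:R * (M * h * (h + r * nrm (w - 1))).
Proof.
move=> fM M0 r_gt0 rr h0 Mh Mw; set eta := nrm (w - 1).
have eta0 : 0 < eta by rewrite nrm_gt0 // subr_eq0.
(* The second-order combination of [holo_bound] at the vertex [p r k], with its radial neighbour as
   [b] and the next vertex as [c], divided by the common factor [w ^+ k]. *)
pose D k := (r%:C * (w - 1)) *: (f (p (r + h) k) - f (p r k)) -
  h%:C *: (f (p r k.+1) - f (p r k)).
have Db k : nrm (D k) <= M * (h * (r * eta) * (h + r * eta)).
  have ba : p (r + h) k - p r k = w ^+ k * h%:C by rewrite /p rmorphD /=; ring.
  have ca : p r k.+1 - p r k = w ^+ k * (r%:C * (w - 1)) by rewrite /p exprS; ring.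
  have nba : nrm (p (r + h) k - p r k) = h.
    by rewrite ba nrmM nrm_wX mul1r nrm_real gtr0_norm.
  have nca : nrm (p r k.+1 - p r k) = r * eta.
    by rewrite ca !nrmM nrm_wX mul1r nrm_real gtr0_norm.
  have [|||_] := fM (p r k) (p (r + h) k) (p r k.+1).
  - by rewrite nrm_p gtr0_norm.
  - by rewrite nrmBC nba.
  - by rewrite nrmBC nca.
  rewrite nba nca ba ca -!scalerA -scalerBr nrmZ nrm_wX mul1r scalerA => /le_trans; apply.
  have hre : 0 < h * (r * eta) by rewrite !mulr_gt0.
  rewrite ler_wpM2l // ler_pM2l //.
  by rewrite (le_trans (nrm_sub_trans (p r k) _ _)) // nba nrmBC nca.
have SD : \sum_(k < n) D k = (r%:C * (w - 1)) *: (S (r + h) - S r).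
  rewrite /D sumrB -!scaler_sumr sumrB.
  rewrite -(big_mkord xpredT (fun k => f (p r k.+1) - f (p r k))) telescope_sumr //.
  by rewrite /p wn expr0 subrr scaler0 subr0.
have := @nrm_sum _ _ n D _ (fun k => Db k).
rewrite SD nrmZ nrmM nrm_real gtr0_norm // -/eta -ler_pdivlMl ?mulr_gt0 // => /le_trans; apply.
rewrite le_eqVlt; apply/orP; left; apply/eqP; field.
by rewrite !gt_eqF.
Qed.

(** The radius grows from 0, where the polygon collapses to the centre, to [r] in [m] steps of
    length [h]. Every step but the first costs [K] per vertex by [mean_step], and on the last circle
    [f] is at most [e]. *)
Lemma mean_bound (M r e : R) m :
  (forall a b c, nrm a <= r -> M * nrm (a - b) < 1 -> M * nrm (a - c) < 1 ->
    holo_bound f M a b c) -> 0 <= M -> 0 < r -> (0 < m)%N ->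
  M * (r / m%:R) < 1 -> M * (r * nrm (w - 1)) < 1 ->
  (forall z, nrm z = r -> nrm (f z) <= e) ->
  nrm (f 0) <= e + M * (r / m%:R) + M * r * (r / m%:R + r * nrm (w - 1)).
Proof.
move=> fM M0 r0 m0 Mh Mw fe; set h := r / m%:R in Mh *.
have h0 : 0 < h by rewrite divr_gt0 // ltr0n.
have S0 : S 0 = n%:R *: f 0.
  rewrite /S (eq_bigr (fun=> f 0)) => [|k _]; last by rewrite /p mul0r.
  by rewrite sumr_const card_ord scaler_nat.
set K := M * h * (h + r * nrm (w - 1)).
have SK i : (i < m)%N ->
    nrm (S (i.+1%:R * h) - S 0) <= n%:R * (M * h) + i%:R * (n%:R * K).
  elim: i => [_|i IH im].
    (* At radius 0 there is no tangential direction to divide by, so the first step uses the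
       Lipschitz bound and costs [M * h] per vertex. *)
    rewrite !mul0r addr0 mul1r /S -sumrB; apply: nrm_sum => k.
    have hk : nrm (p h k - p 0 k) = h.
      by rewrite [p 0 k]mul0r subr0 nrm_p gtr0_norm.
    have [|||+ _] := fM (p 0 k) (p h k) (p h k); last by rewrite hk.
    - by rewrite nrm_p normr0 ltW.
    - by rewrite nrmBC hk.
    - by rewrite nrmBC hk.
  have ir : i.+1%:R * h <= r.
    by rewrite /h mulrCA ger_pMr // ler_pdivrMr ?ltr0n // mul1r ler_nat ltnW.
  rewrite (le_trans (nrm_sub_trans (S (i.+1%:R * h)) _ _)) //.
  have -> : n%:R * (M * h) + i.+1%:R * (n%:R * K) =
      n%:R * K + (n%:R * (M * h) + i%:R * (n%:R * K)) by rewrite -natr1; ring.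
  rewrite lerD ?IH ?(ltnW im) // -[in S (i.+2%:R * h)]natr1 mulrDl mul1r.
  have irw : i.+1%:R * h * nrm (w - 1) <= r * nrm (w - 1) by rewrite ler_wpM2r ?nrm_ge0.
  have i0 : 0 < i.+1%:R * h by rewrite mulr_gt0 ?ltr0n.
  have iw : M * (i.+1%:R * h * nrm (w - 1)) < 1.
    by apply: le_lt_trans Mw; rewrite ler_wpM2l.
  apply: le_trans (mean_step fM M0 i0 ir h0 Mh iw) _.
  by rewrite ler_wpM2l // /K ler_wpM2l ?lerD2l // mulr_ge0 // ltW.
have mh : m%:R * h = r by rewrite /h mulrC divfK // pnatr_eq0 -lt0n.
have := SK m.-1; rewrite prednK // mh => /(_ (leqnn _)) Sr.
have Se : nrm (S r) <= n%:R * e.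
  by apply: nrm_sum => k; apply: fe; rewrite nrm_p gtr0_norm.
have n0R : (0 : R) < n%:R by rewrite ltr0n.
rewrite -(ler_pM2l n0R).
have -> : n%:R * nrm (f 0) = nrm (S 0).
  by rewrite S0 nrmZ -[n%:R in RHS](rmorph_nat (real_complex R)) nrm_real ger0_norm.
have := nrmB (S r) (S r - S 0); rewrite opprB addrC subrK.
have mK : m.-1%:R * (n%:R * K) <= n%:R * (M * r * (h + r * nrm (w - 1))).
  rewrite /K; set q := h + _.
  have q0 : 0 <= q by rewrite addr_ge0 ?mulr_ge0 ?nrm_ge0 // ltW.
  have -> : M * r * q = m%:R * (M * h * q) by rewrite -mh; ring.
  rewrite [leRHS]mulrCA ler_wpM2r ?ler_nat ?leq_pred // mulr_ge0 // !mulr_ge0 //.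
  exact: ltW.
rewrite !mulrDr; move: mK Sr Se; rewrite !mulrDr; lra.
Qed.

End Mean.

(** The order of choices matters: the radius [r] from the decay, then [M] on the disc of that
    radius, then the number [m] of radial steps, and finally a polygon fine enough for [m]. *)
Theorem liouville_zero f : (forall z, holo_at f z) ->
  (forall e : R, 0 < e -> exists2 r : R, 0 < r & forall z, nrm z = r -> nrm (f z) <= e) ->
  f 0 = 0.
Proof.
move=> fh f_oo; apply: nrm0_eq0; apply/eqP; rewrite eq_le nrm_ge0 andbT.
apply/ler_addgt0Pr => e e0; rewrite add0r.
have [r r0 fe] : exists2 r : R, 0 < r & forall z, nrm z = r -> nrm (f z) <= e / 2.
  by apply: f_oo; rewrite divr_gt0.
have [M M0 fM] := holo_uniform r fh.
(* With [nrm (w - 1)] below [1 / m], the error terms of [mean_bound] add up to at most [K / m]. *)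
pose K := M * r + 2 * (M * r * r).
have K0 : 0 < K by rewrite addr_gt0 ?mulr_gt0.
pose m := (Num.truncn (Num.max (M * r) (K / (e / 2)))).+1.
have m0 : (0 < m%:R :> R) by rewrite ltr0n.
have : Num.max (M * r) (K / (e / 2)) < m%:R by exact: truncnS_gt.
rewrite gt_max => /andP[mM mK].
have [n [w [n0 wn w1 wm]]] := @small_unity_root m%:R^-1 (ltac:(by rewrite invr_gt0)).
have Mm : M * r / m%:R < 1 by rewrite ltr_pdivrMr // mul1r.
have := @mean_bound f n w n0 wn w1 M r (e / 2) m fM (ltW M0) r0 isT.
have rw : r * nrm (w - 1) <= r / m%:R by rewrite ler_pM2l // ltW.
rewrite mulrA => /(_ Mm) H; apply: le_trans (H _ fe) _.
  by rewrite (le_lt_trans _ Mm) // -mulrA ler_pM2l.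
have Ke : K / m%:R <= e / 2.
  by move: mK; rewrite ltr_pdivrMr ?divr_gt0 // mulrC -ltr_pdivrMr // => /ltW.
have : M * r * (r * nrm (w - 1)) <= M * r * (r / m%:R) by rewrite ler_pM2l // mulr_gt0.
move: Ke; rewrite /K mulrDr !mulrDl !mulrA.
lra.
Qed.

End Liouville.

(** * Resolvents and Cauchy integrals of the resolvent *)

Section Resolvent.
Variable R : realType.
Local Notation C := (CC R).
Variables (X : completeNormedModType C) (A : X -> X).
Hypothesis bA : blin A.

Let cX : cauchy_complete X := @complete_cauchy R X.

Lemma resolventP (l : C) : ~ spectrum A l ->
  [/\ blin (resolvent A l), forall x, resolvent A l (A x - l *: x) = x &
      forall x, A (resolvent A l x) - l *: resolvent A l x = x].
Proof.
move=> /contrapT[B [/bounded_opP bB [BA AB]]].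
suff -> : resolvent A l = B by [].
apply/funext => x; rewrite /resolvent; case: xgetP => [y _ /= <-|/(_ (B x)) /=].
  by rewrite BA.
by rewrite AB.
Qed.

Lemma resolvent_identity (a b : C) y : ~ spectrum A a -> ~ spectrum A b ->
  resolvent A b y - resolvent A a y = (b - a) *: resolvent A a (resolvent A b y).
Proof.
move=> /resolventP[bRa Ra _] /resolventP[bRb _ Rb].
set z := resolvent A b y.
have -> : resolvent A a y = z - (b - a) *: resolvent A a z; last by rewrite opprB addrC subrK.
rewrite -{1}(Ra z) -(blinZ bRa) -(blinB bRa); congr resolvent.
by rewrite scalerBl -[in LHS](Rb y) -/z opprB addrA subrK.
Qed.

Lemma resolvent_comm (T : X -> X) (l : C) x : ~ spectrum A l -> blin T ->
  (forall y, T (A y) = A (T y)) -> T (resolvent A l x) = resolvent A l (T x).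
Proof.
move=> /resolventP[_ RA AR] bT TA.
by rewrite -[in RHS](AR x) (blinB bT) (blinZ bT) TA RA.
Qed.

(** By the resolvent identity, the norm of [resolvent A b y] is at most [M * nrm y] plus half of
    itself, and the half is absorbed. *)
Lemma resolvent_near_bound (a b : C) (M : R) :
  (forall y, nrm (resolvent A a y) <= M * nrm y) ->
  ~ spectrum A a -> ~ spectrum A b -> M * nrm (a - b) <= 1 / 2 ->
  forall y, nrm (resolvent A b y) <= 2 * M * nrm y.
Proof.
move=> RM ra rb ab y; have E := resolvent_identity y ra rb.
have : nrm (resolvent A b y) <= nrm (resolvent A a y) +
    nrm (resolvent A b y - resolvent A a y).
  by rewrite (le_trans _ (nrmD _ _)) // addrC subrK.
rewrite E nrmZ nrmBC; move: (RM y) (RM (resolvent A b y)) ab.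
move: (nrm_ge0 (a - b)) (nrm_ge0 (resolvent A b y)) (nrm_ge0 (resolvent A a (resolvent A b y))).
set u := nrm (resolvent A b y); set v := nrm (resolvent A a _); set w := nrm (a - b).
move=> w0 u0 v0 h1 h2 h3 h4.
have : w * v <= 1 / 2 * u.
  by apply: (@le_trans _ _ (w * (M * u))); [rewrite ler_wpM2l|rewrite mulrA (mulrC w) ler_wpM2r].
lra.
Qed.

Lemma resolvent_bound (a : C) : ~ spectrum A a ->
  exists2 M : R, 0 < M & forall y, nrm (resolvent A a y) <= M * nrm y.
Proof.
move=> /resolventP[[_ [M M0 RM]] _ _]; exists (M + 1) => [|y]; first by rewrite ltr_wpDl.
by rewrite (le_trans (RM y)) // ler_wpM2r ?nrm_ge0 // lerDl.
Qed.

Lemma closed_far (S : set C) (z : C) : closed S -> ~ S z ->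
  exists2 d : R, 0 < d & forall y, nrm (z - y) < d -> ~ S y.
Proof.
move=> cS Sz; have : nbhs z (~` S) by apply: open_nbhs_nbhs; split=> //; exact: closed_openC.
by move=> /nbhs_nrm[d d0 H]; exists d.
Qed.

Lemma holo_at_ext (f h : C -> X) (z : C) (d : R) : 0 < d ->
  (forall y, nrm (z - y) < d -> f y = h y) -> holo_at f z -> holo_at h z.
Proof.
move=> d0 fh [e e0 [M H]]; exists (Num.min d e); first by rewrite lt_min d0.
exists M => a b c; rewrite !lt_min => /andP[ad ae] /andP[bd be] /andP[cd ce].
by have := H a b c ae be ce; rewrite /holo_bound !fh.
Qed.

(** Two uses of the resolvent identity turn the second-order combination into
    [(b - a) (c - a) (b - c)] times [R_a R_c R_b y]; each resolvent costs a factor [N]. *)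
Lemma holo_resolvent (z : C) (d : R) y : 0 < d ->
  (forall b, nrm (z - b) < d -> ~ spectrum A b) ->
  holo_at (fun l => resolvent A l y) z.
Proof.
move=> d0 zd; have rz : ~ spectrum A z by apply: zd; rewrite subrr nrm0.
have [M M0 RM] := resolvent_bound rz.
pose N := 2 * M; have N0 : 0 <= N by rewrite mulr_ge0 // ltW.
pose B := N * N * nrm y; pose D := N * (N * (N * nrm y)).
exists (Num.min d (1 / 2 / M)); first by rewrite lt_min d0 divr_gt0.
exists (Num.max B D) => a b c.
have RN t : nrm (z - t) < Num.min d (1 / 2 / M) ->
    ~ spectrum A t /\ forall x, nrm (resolvent A t x) <= N * nrm x.
  rewrite lt_min => /andP[/zd rt tM]; split=> //; apply: resolvent_near_bound RM rz rt _.
  by rewrite mulrC -ler_pdivlMr // ltW.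
move=> /RN[ra Na] /RN[rb Nb] /RN[rc Nc]; split.
  rewrite resolvent_identity // nrmZ mulrC ler_wpM2r ?nrm_ge0 //.
  rewrite le_max; apply/orP; left; rewrite (le_trans (Na _)) // /B -mulrA ler_wpM2l //.
rewrite !resolvent_identity //.
have [bRa _ _] := resolventP ra.
rewrite scalerA [(c - a) * _]mulrC -scalerA -scalerBr -scalerBr -(blinB bRa).
rewrite (resolvent_identity y rc rb) (blinZ bRa) !nrmZ.
have -> : Num.max B D * (nrm (b - a) * nrm (c - a) * nrm (b - c)) =
  nrm (b - a) * (nrm (c - a) * (nrm (b - c) * Num.max B D)) by ring.
rewrite !ler_wpM2l ?nrm_ge0 // le_max; apply/orP; right.
rewrite (le_trans (Na _)) // /D ler_wpM2l // (le_trans (Nc _)) // ler_wpM2l //.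
Qed.

(** * Cauchy integrals of the resolvent along the cycle *)

Section Calculus.
Variable G : seq (R -> C).
Hypothesis Gcl : forall g, g \in G -> closed_lipschitz_curve g.
Hypothesis Gres : forall g t, g \in G -> 0 <= t <= 1 -> ~ spectrum A (g t).

Lemma resolvent_cycle_bound : exists2 M : R, 0 < M &
  forall g t y, g \in G -> 0 <= t <= 1 -> nrm (resolvent A (g t) y) <= M * nrm y.
Proof.
have [M N g MN H t y t1|g gG|M M0 H] := @seq_uniform R G (fun M g => forall t y, 0 <= t <= 1 ->
  nrm (resolvent A (g t) y) <= M * nrm y).
- by rewrite (le_trans (H t y t1)) // ler_wpM2r ?nrm_ge0.
- have [M N t MN H y|t t1|M M0 H] := @unit_uniform R (fun M t => forall y,
    nrm (resolvent A (g t) y) <= M * nrm y).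
  + by rewrite (le_trans (H y)) // ler_wpM2r ?nrm_ge0.
  + have [M M0 RM] := resolvent_bound (Gres gG t1).
    have d0 : 0 < 1 / 2 / M by rewrite divr_gt0.
    have [e e0 He] := curve_near Gcl gG t1 d0.
    exists e => //; exists (2 * M) => s s1 /(He _ s1) h.
    apply: resolvent_near_bound RM (Gres gG t1) (Gres gG s1) _.
    by rewrite mulrC -ler_pdivlMr // ltW.
  + by exists M => t y t1; exact: H.
- by exists M => // g t y gG t1; exact: H.
Qed.

Lemma lip_resolvent y : lip_on G (fun l => resolvent A l y).
Proof.
move=> g gG; have [M M0 RM] := resolvent_cycle_bound.
have [K gK] := closed_lipschitz_lip (Gcl gG).
exists (K * (M * (M * nrm y))) => s t s1 t1.
rewrite resolvent_identity; try exact: Gres.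
rewrite nrmZ mulrAC ler_pM ?nrm_ge0 ?gK // (le_trans (RM _ _ _ gG t1)) //.
by rewrite ler_wpM2l ?RM // ltW.
Qed.

(** The Riesz-Dunford integral up to sign: [resolvent] is [(A - z)^-1], so the weight 1 gives
    [- P]. *)
Definition fcalc (w : C -> C) (y : X) : X :=
  (two_pi_i R)^-1 *: cycle_integral G (fun z => w z *: resolvent A z y).

Lemma lip_fcalc (w : C -> C) y : lip_on G w -> lip_on G (fun z => w z *: resolvent A z y).
Proof. by move=> lw g gG; apply: lip_scale; [exact: lw|exact: lip_resolvent]. Qed.

Lemma fcalcD (w v : C -> C) y : lip_on G w -> lip_on G v ->
  fcalc (fun z => w z + v z) y = fcalc w y + fcalc v y.
Proof.
move=> lw lv; rewrite /fcalc -scalerDr -cycle_integralD //; try exact: lip_fcalc.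
by congr (_ *: _); apply: eq_cycle_integral => g t _ _; rewrite scalerDl.
Qed.

Lemma fcalcZ (c : C) (w : C -> C) y : lip_on G w -> fcalc (fun z => c * w z) y = c *: fcalc w y.
Proof.
move=> lw; rewrite /fcalc scalerA mulrC -scalerA; congr (_ *: _).
rewrite -(cycle_integral_map Gcl cX cX (blin_scale X c) (lip_fcalc y lw)).
by apply: eq_cycle_integral => g t _ _; rewrite scalerA.
Qed.

Lemma eq_fcalc w v y : (forall g t, g \in G -> 0 <= t <= 1 -> w (g t) = v (g t)) ->
  fcalc w y = fcalc v y.
Proof.
by move=> wv; congr (_ *: _); apply: eq_cycle_integral => g t gG t1; rewrite wv.
Qed.

Lemma fcalc_bound : exists2 K : R, 0 <= K & forall (w : C -> C) y (B : R), lip_on G w -> 0 <= B ->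
  (forall g t, g \in G -> 0 <= t <= 1 -> nrm (w (g t)) <= B) ->
  nrm (fcalc w y) <= K * B * nrm y.
Proof.
have [M M0 RM] := resolvent_cycle_bound; have [K K0 HK] := cycle_integral_bound Gcl.
exists (nrm (two_pi_i R)^-1 * K * M) => [|w y B lw B0 wB].
  by rewrite !mulr_ge0 ?nrm_ge0 // ltW.
rewrite nrmZ -!mulrA ler_wpM2l ?nrm_ge0 // (le_trans (HK _ _ (B * (M * nrm y)) _ _ _ _)) //.
- exact: lip_fcalc.
- by rewrite !mulr_ge0 ?nrm_ge0 // ltW.
- by move=> g t gG t1; rewrite nrmZ ler_pM ?nrm_ge0 ?wB ?RM.
- by rewrite (mulrCA B).
Qed.

Lemma blin_fcalc (w : C -> C) : lip_on G w -> blin (fcalc w).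
Proof.
move=> lw; split=> [a x y|].
  have bR z g t : g \in G -> 0 <= t <= 1 -> z = g t -> blin (resolvent A z).
    by move=> gG t1 ->; have [] := resolventP (Gres gG t1).
  rewrite /fcalc scalerA mulrC -scalerA -scalerDr; congr (_ *: _).
  rewrite -(cycle_integral_map Gcl cX cX (blin_scale X a) (lip_fcalc x lw)).
  rewrite -cycle_integralD //; last 2 first.
  - by move=> g gG; exact: (lip_blin (blin_scale X a) (lip_fcalc x lw gG)).
  - exact: lip_fcalc.
  apply: eq_cycle_integral => g t gG t1.
  by rewrite (bR _ _ _ gG t1 erefl).1 scalerDr !scalerA mulrC.
have [K K0 HK] := fcalc_bound.
have [M N g MN H t t1|g gG|B B0 wB] := @seq_uniform R G (fun B g => forall t, 0 <= t <= 1 ->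
  nrm (w (g t)) <= B).
- by rewrite (le_trans (H t t1)).
- by have [B _ H] := lip_bounded (lw g gG); exists B.
- exists (K * B) => [|y]; first by rewrite mulr_ge0 // ltW.
  by apply: HK => // [|g t gG]; [exact: ltW|exact: wB].
Qed.

Lemma fcalc_comm (T : X -> X) (w : C -> C) x : blin T -> (forall y, T (A y) = A (T y)) ->
  lip_on G w -> T (fcalc w x) = fcalc w (T x).
Proof.
move=> bT TA lw; rewrite /fcalc (blinZ bT); congr (_ *: _).
rewrite -(cycle_integral_map Gcl cX cX bT (lip_fcalc x lw)).
apply: eq_cycle_integral => g t gG t1; rewrite (blinZ bT).
by rewrite (resolvent_comm _ (Gres gG t1)).
Qed.

Lemma lip_cst1 : lip_on G (fun=> 1 : C).
Proof. by move=> g _; exists 0 => s t _ _; rewrite subrr nrm0 mul0r. Qed.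

Local Notation P := (spectral_projection A G).

Lemma spectral_projectionE y : P y = - fcalc (fun=> 1) y.
Proof.
rewrite /spectral_projection /fcalc; congr (- (_ *: _)).
by apply: eq_cycle_integral => g t _ _; rewrite scale1r.
Qed.

Lemma blin_projection : blin P.
Proof.
have -> : P = (fun x => -1 *: x) \o fcalc (fun=> 1).
  by apply/funext => y; rewrite spectral_projectionE /= scaleN1r.
by apply: blin_comp; [exact: blin_scale|exact: blin_fcalc lip_cst1].
Qed.

Lemma projection_comm (T : X -> X) x : blin T -> (forall y, T (A y) = A (T y)) ->
  T (P x) = P (T x).
Proof.
move=> bT TA; rewrite !spectral_projectionE (blinN bT); congr (- _).
exact: (fcalc_comm _ bT TA lip_cst1).
Qed.

(* [cauchy_op m] is [f_m(A)] for [f_m(z) = (w(m) - w(z)) / (z - m)], with [w] the winding number of [G]: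
   it inverts [A - m] up to the projection, also at points [m] of the spectrum. *)
Definition cauchy_op (m : C) : X -> X := fcalc (fun z => (z - m)^-1).

(** Since [(A - m) R_z = 1 + (z - m) R_z], the integrand splits into [(z - m)^-1 y], which yields
    the winding number, and [R_z y], which yields [- P y]. *)
Lemma cauchy_op_inv (m : C) d y : 0 < d -> far G m d ->
  A (cauchy_op m y) - m *: cauchy_op m y = winding_number G m *: y - P y.
Proof.
move=> d0 md; have lm := lip_inv Gcl d0 md.
pose T x := A x - m *: x.
have bT : blin T.
  split=> [a x z|]; first by rewrite /T bA.1 scalerDr scalerBr !scalerA [m * a]mulrC opprD addrACA.
  case: (bA) => _ [K K0 AK]; exists (K + nrm m) => [|x]; first by rewrite addr_ge0 ?nrm_ge0.
  by rewrite (le_trans (nrmB _ _)) // mulrDl nrmZ lerD.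
rewrite -/(T _) /cauchy_op /fcalc (blinZ bT).
rewrite -(cycle_integral_map Gcl cX cX bT (lip_fcalc y lm)).
rewrite spectral_projectionE opprK /winding_number -scalerA /fcalc -scalerDr.
congr (_ *: _).
have cC : cauchy_complete C := @cauchy_complete_CC R.
have E := cycle_integral_map Gcl cC cX (blin_scalel y) lm.
rewrite -E -cycle_integralD //; last 2 first.
- by move=> g gG; exact: (lip_blin (blin_scalel y) (lm g gG)).
- exact: lip_fcalc lip_cst1.
apply: eq_cycle_integral => g t gG t1.
have [_ _ AR] := resolventP (Gres gG t1); have gm := far_neq d0 md gG t1.
rewrite (blinZ bT) /T; set z := resolvent A (g t) y.
have -> : A z - m *: z = y + (g t - m) *: z.
  by rewrite -[in RHS](AR y) -/z scalerBl addrA subrK.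
by rewrite scalerDr scalerA mulVf.
Qed.

(** The scalar kernels [u a z = (z - a)^-1] satisfy the analogue of the resolvent identity, so the
    second-order combination is [(b - a) (c - a) (b - c)] times [fcalc] of [u a * u b * u c]. *)
Lemma holo_cauchy_op (m : C) d y : 0 < d -> far G m d ->
  holo_at (fun l => cauchy_op l y) m.
Proof.
move=> d0 md; have [K K0 HK] := fcalc_bound.
pose e := d / 2; have e0 : 0 < e by rewrite divr_gt0.
have ei : 0 <= e^-1 by rewrite invr_ge0 ltW.
pose B := K * (e^-1 * e^-1) * nrm y; pose D := K * (e^-1 * (e^-1 * e^-1)) * nrm y.
exists e => //; exists (Num.max B D) => a b c /ltW ma /ltW mb /ltW mc.
have fa := far_near md ma; have fb := far_near md mb; have fc := far_near md mc.
have la := lip_inv Gcl e0 fa; have lb := lip_inv Gcl e0 fb; have lc := lip_inv Gcl e0 fc.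
pose u (a z : C) : C := (z - a)^-1.
have lmul (v w : C -> C) : lip_on G v -> lip_on G w -> lip_on G (fun z => v z * w z).
  by move=> lv lw g gG; apply: lip_mul; [exact: lv|exact: lw].
have lcst (x : C) (v : C -> C) : lip_on G v -> lip_on G (fun z => x * v z).
  by move=> lv g gG; exact: (lip_blin (blin_mul x) (lv g gG)).
have diff s t : far G s e -> far G t e -> lip_on G (u s) -> lip_on G (u t) ->
    cauchy_op t y - cauchy_op s y = (t - s) *: fcalc (fun z => u s z * u t z) y.
  move=> fs ft ls lt.
  have lst := lmul _ _ ls lt; rewrite -fcalcZ //.
  have -> : cauchy_op t y = fcalc (fun z => u s z + (t - s) * (u s z * u t z)) y.
    apply: eq_fcalc => g r gG r1.
    have h1 := far_neq e0 fs gG r1; have h2 := far_neq e0 ft gG r1.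
    by rewrite /u; field; rewrite h1 h2.
  by rewrite fcalcD //; [rewrite addrAC subrr add0r|exact: lcst].
split.
  rewrite (diff a b) // nrmZ mulrC ler_wpM2r ?nrm_ge0 // le_max; apply/orP; left.
  apply: HK; [exact: lmul|exact: mulr_ge0|move=> g t gG t1].
  by rewrite nrmM ler_pM ?nrm_ge0 // (far_inv e0 _ gG t1).
rewrite (diff a b) // (diff a c) // (scalerA (c - a)) (scalerA (b - a))
  [(c - a) * _]mulrC -scalerBr.
have -> : fcalc (fun z => u a z * u b z) y =
    fcalc (fun z => u a z * u c z + (b - c) * (u a z * (u b z * u c z))) y.
  apply: eq_fcalc => g r gG r1.
  have h1 := far_neq e0 fa gG r1; have h2 := far_neq e0 fb gG r1; have h3 := far_neq e0 fc gG r1.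
  by rewrite /u; field; rewrite h1 h2 h3.
have lab := lmul _ _ la lc; have labc := lmul _ _ la (lmul _ _ lb lc).
rewrite fcalcD //; last exact: lcst.
rewrite addrAC subrr add0r fcalcZ // (scalerA _ (b - c)) nrmZ !nrmM mulrC
  ler_wpM2r ?mulr_ge0 ?nrm_ge0 //.
rewrite le_max; apply/orP; right.
apply: HK => //; first by rewrite !mulr_ge0.
move=> g t gG t1; rewrite !nrmM.
have h1 := far_inv e0 fa gG t1; have h2 := far_inv e0 fb gG t1; have h3 := far_inv e0 fc gG t1.
by rewrite !ler_pM ?mulr_ge0 ?nrm_ge0.
Qed.

End Calculus.
End Resolvent.

(** * The spectral projection *)

Section SpectralProjection.
Variable R : realType.
Local Notation C := (CC R).
Variables (X : completeNormedModType C) (A : X -> X) (L : set C) (G : seq (R -> C)).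
Hypotheses (bA : blin A) (LA : spectral_set A L) (GL : separating_contour A L G).

Let Gcl : forall g, g \in G -> closed_lipschitz_curve g. Proof. by case: GL. Qed.
Let Gres : forall g t, g \in G -> 0 <= t <= 1 -> ~ spectrum A (g t).
Proof. by case: GL => _ []. Qed.

Local Notation P := (spectral_projection A G).
Local Notation Q := (cauchy_op A G).

Let bP : blin P := blin_projection Gcl Gres.

Lemma spectrum_far (m : C) : spectrum A m -> exists2 d : R, 0 < d & far G m d.
Proof.
by move=> sm; apply: (far_exists Gcl) => g t gG t1 gm; apply: (Gres gG t1); rewrite gm.
Qed.

Lemma projection_commA x : P (A x) = A (P x).
Proof. by rewrite -(projection_comm Gcl Gres). Qed.

Lemma cauchy_op_commA (m : C) d x : 0 < d -> far G m d -> Q m (A x) = A (Q m x).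
Proof. by move=> d0 md; rewrite /cauchy_op -(fcalc_comm Gcl Gres) //; exact: lip_inv md. Qed.

Lemma cauchy_op_L (m : C) x : L m -> A (Q m x) - m *: Q m x = x - P x.
Proof.
move=> Lm; have [d d0 md] := spectrum_far (LA.1 _ Lm).
by rewrite (cauchy_op_inv bA Gcl Gres _ d0 md) GL.2.2.1 // scale1r.
Qed.

Lemma cauchy_op_notL (m : C) x : spectrum A m -> ~ L m ->
  A (Q m x) - m *: Q m x = - P x.
Proof.
move=> sm Lm; have [d d0 md] := spectrum_far sm.
by rewrite (cauchy_op_inv bA Gcl Gres _ d0 md) GL.2.2.2 // scale0r sub0r.
Qed.

(** * Idempotence of the projection *)

Section Defect.
Variable x : X.
Let N := P (x - P x).

(* An entire solution [l |-> (A - l)^-1 N] that vanishes at infinity. *)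
Let f (l : C) : X :=
  if pselect (spectrum A l) then
    if pselect (L l) then Q l (P x) else - Q l (x - P x)
  else resolvent A l N.

Let NE : N = P x - P (P x). Proof. exact: blinB. Qed.

Lemma defect_solution l : A (f l) - l *: f l = N.
Proof.
rewrite /f; case: pselect => [sl|rl]; last by have [_ _ ->] := resolventP rl.
case: pselect => [Ll|Ll]; first by rewrite cauchy_op_L // NE.
by rewrite (blinN bA) scalerN -opprD cauchy_op_notL // opprK.
Qed.

Let resolvent_uniq (l : C) y z : ~ spectrum A l -> A y - l *: y = z -> resolvent A l z = y.
Proof. by move=> /resolventP[_ RA _] <-; exact: RA. Qed.

Lemma defect_holo z : holo_at f z.
Proof.
(* The spectrum is the union of the two closed pieces of the spectral set. *)
have closedS : closed (spectrum A).
  rewrite -(setDUK LA.1); apply: closedU; [exact: LA.2.1|exact: LA.2.2].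
have [sz|rz] := pselect (spectrum A z); last first.
  have [d d0 H] := closed_far closedS rz.
  apply: (holo_at_ext d0 _ (holo_resolvent N d0 H)) => y /H ry.
  by rewrite /f; case: pselect.
have [e e0 ze] := spectrum_far sz.
have e20 : 0 < e / 2 by rewrite divr_gt0.
(* Winding numbers are prescribed on the spectrum only. Local constancy carries the value at [z] to
   nearby resolvent points, where it identifies the local formula with [resolvent A y N]. *)
have wz y : nrm (z - y) < e / 2 -> winding_number G y = winding_number G z.
  by move=> /ltW; exact: (winding_locally_cst Gcl e0 ze).
have [Lz|Lz] := pselect (L z).
  (* The rest of the spectrum is closed and misses [z], so every point near [z] lies in [L] or off
     the spectrum. *)
  have [d d0 H] := closed_far LA.2.2 (fun h : (spectrum A `\` L) z => h.2 Lz).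
  apply: (@holo_at_ext _ _ (fun l => Q l (P x)) _ _ (Num.min d (e / 2))).
  - by rewrite lt_min d0.
  - move=> y; rewrite lt_min => /andP[yd ye]; rewrite /f.
    case: pselect => [sy|ry]; first by case: pselect => // Ly; case: (H y yd).
    symmetry; apply: resolvent_uniq => //.
    rewrite (cauchy_op_inv bA Gcl Gres _ e20 (far_near ze (ltW ye))) wz //.
    by rewrite GL.2.2.1 // scale1r NE.
  - exact: (holo_cauchy_op Gcl Gres _ e0 ze).
have [d d0 H] := closed_far LA.2.1 Lz.
(* The sign of [- Q l (x - P x)] is moved into the argument, so that [holo_cauchy_op] applies
   directly. *)
apply: (@holo_at_ext _ _ (fun l => Q l (P x - x)) _ _ (Num.min d (e / 2))).
- by rewrite lt_min d0.
- move=> y; rewrite lt_min => /andP[yd ye]; rewrite /f.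
  have ye2 := far_near ze (ltW ye).
  have bQ : blin (Q y) := blin_fcalc Gcl Gres (lip_inv Gcl e20 ye2).
  case: pselect => [sy|ry].
    by case: pselect => [/(H y yd)|nLy] //=; rewrite -(blinN bQ) opprB.
  symmetry; apply: resolvent_uniq => //.
  rewrite (cauchy_op_inv bA Gcl Gres _ e20 ye2) wz // GL.2.2.2 // scale0r sub0r.
  by rewrite -(blinN bP) opprB.
- exact: (holo_cauchy_op Gcl Gres _ e0 ze).
Qed.

Lemma projection_defect : P (x - P x) = 0.
Proof.
have f0 : f 0 = 0.
  apply: liouville_zero defect_holo _ => e e0.
  case: bA => _ [K K0 AK]; have Ne : 0 <= nrm N / e by rewrite divr_ge0 ?nrm_ge0 // ltW.
  (* The equation gives [nrm l * nrm (f l) <= K * nrm (f l) + nrm N]; on this circle it becomes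
     [(1 + nrm N / e) * nrm (f l) <= nrm N]. The summand 1 keeps the estimate effective when
     [N = 0]. *)
  exists (K + 1 + nrm N / e) => [|l lr]; first by rewrite ltr_wpDr // ltr_wpDl.
  have fl := defect_solution l; have h1 := AK (f l).
  have h2 : nrm (l *: f l) <= nrm (A (f l)) + nrm N.
    by rewrite -fl -[X in nrm X <= _](subKr (A (f l))) nrmB.
  have h3 : nrm (f l) + nrm N / e * nrm (f l) <= nrm N.
    by move: h2; rewrite nrmZ lr !mulrDl mul1r; lra.
  rewrite leNgt; apply/negP => ef.
  have : nrm N <= nrm N / e * nrm (f l).
    by rewrite -mulrA ler_peMr ?nrm_ge0 // mulrC ler_pdivlMr // mul1r ltW.
  by lra.
(* The value at the single point 0 is enough: the equation there reads [A (f 0) = N]. *)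
by rewrite -/N -(defect_solution 0) f0 (blin0 bA) scaler0 subr0.
Qed.

End Defect.

Lemma projection_idem x : P (P x) = P x.
Proof.
by apply/esym/eqP; rewrite -subr_eq0 -(blinB bP) projection_defect.
Qed.

(** Every factor is [S] or [A]: [S P = P S] relates [B = S P] to [P] on both sides, and [A S P = P]
    recovers [P] from [B]. *)
Lemma mary_of_partial_inverse (S : X -> X) : blin S ->
  (forall x, S (A x) = A (S x)) -> (forall x, A (S (P x)) = P x) ->
  mary_invertible_along A P.
Proof.
move=> bS SA ASP; have SP x : S (P x) = P (S x) by exact: (projection_comm Gcl Gres).
exists (S \o P); split; first by apply/bounded_opP; exact: blin_comp.
split=> [x|] /=; first by rewrite ASP projection_idem.
exists S, S, A, A; split.
  by split; apply/bounded_opP.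
split=> x //=; first by rewrite projection_commA SA ASP.
Qed.

(** Off the spectrum the cycle may pass through 0 and its winding number there is not prescribed, so
    [Q 0] is used only when 0 is in the spectrum. *)
Lemma spectral_projection_mary : ~ L 0 -> mary_invertible_along A P.
Proof.
move=> L0; have [s0|r0] := pselect (spectrum A 0).
  have [d d0 far0] := spectrum_far s0.
  have bQ : blin (Q 0) := blin_fcalc Gcl Gres (lip_inv Gcl d0 far0).
  apply: (@mary_of_partial_inverse (fun x => - Q 0 x)).
  - have -> : (fun x => - Q 0 x) = (fun x => -1 *: x) \o Q 0.
      by apply/funext => x /=; rewrite scaleN1r.
    by apply: blin_comp => //; exact: blin_scale.
  - by move=> x; rewrite (cauchy_op_commA _ d0) // (blinN bA).
  (* Winding number 0 at 0 gives [A (Q 0 y) = - P y]; idempotence is what makes this the required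
     identity at [y = P x]. *)
  - move=> x; rewrite (blinN bA).
    have := cauchy_op_notL (P x) s0 L0; rewrite scale0r subr0 => ->.
    by rewrite opprK projection_idem.
have [bR RA AR] := resolventP r0.
apply: (mary_of_partial_inverse bR) => x.
  by rewrite (resolvent_comm x r0 bA).
by have := AR (P x); rewrite scale0r subr0.
Qed.

End SpectralProjection.

Theorem theorem4p2 (R : realType) (X : completeNormedModType (CC R))
    (A : X -> X) (L : set (CC R)) (G : seq (R -> CC R)) :
  bounded_op A -> spectral_set A L -> ~ L 0 ->
  separating_contour A L G ->
  mary_invertible_along A (spectral_projection A G).
Proof.
by move=> /bounded_opP bA LA L0 GL; exact: (spectral_projection_mary bA LA GL L0).
Qed.
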